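(* Let $r,s\in C^1[0,\infty)$ and $u\in C[0,\infty)$ be real-valued functions satisfying $$\dot s(t)=-2u(t)r(t),\qquad \dot r(t)=-2u(t)s(t),$$ with $\operatorname{sgn}(u(t))=-\operatorname{sgn}(r(t))$ for all $t>0$, $s(0)>0$ and $r(0)>0$ (so that $r(t),s(t)>0$ for all $t$, and $s^2-r^2$ is constant). Assume $s^2-r^2=0$. Let $k>0$, let $$W_t(x)=\frac{x^{2k-1}r(t)^{-2k}e^{-x/r(t)}}{\Gamma(2k)},\qquad x\in[0,\infty),$$ and let $U_t:\ell^2(\mathbb N)\to L^2([0,\infty),W_t(x)dx)$ be defined by $$[U_te_n](x)=L_n\Big(\frac{x}{r(t)};2k-1\Big).$$ Then $U_t$ is unitary and $U_t\circ\pi_k(L(t))\circ U_t^*=M(x)$.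
   Context: $\mathbb N=\{0,1,2,\dots\}$; $(a)_n=a(a+1)\cdots(a+n-1)$. The Lie algebra considered has basis $H,E,F$ with $[H,E]=2E$, $[H,F]=-2F$, $[E,F]=H$ and $*$-structure $H^*=H$, $E^*=-F$ (i.e. $\mathfrak{su}(1,1)$). The Lax operator is $L(t)=s(t)H+r(t)(E-F)$ (with partner $M(t)=u(t)(E+F)$; the differential equations above are $\dot L=[M,L]$). The positive discrete series representation $\pi_k$, $k>0$, on $\ell^2(\mathbb N)$ with standard orthonormal basis $\{e_n\}_{n\in\mathbb N}$ is given by $\pi_k(H)e_n=2(k+n)e_n$, $\pi_k(E)e_n=\sqrt{(n+1)(2k+n)}\,e_{n+1}$, $\pi_k(F)e_n=-\sqrt{n(2k+n-1)}\,e_{n-1}$, $e_{-1}=0$. Hence $$\pi_k(L(t))e_n=r(t)\sqrt{(n+1)(n+2k)}\,e_{n+1}+s(t)(2k+2n)e_n+r(t)\sqrt{n(n+2k-1)}\,e_{n-1}.$$ These operators are densely defined, with domain $\mathcal D$ the finite linear combinations of the $e_n$; the operator identity in the claim is understood on $U_t(\mathcal D)$. Orthonormal Laguerre polynomials: $$L_n(x;\alpha)=(-1)^n\sqrt{\frac{(\alpha+1)_n}{n!}}\;{}_1F_1\Big({-n\atop\alpha+1};x\Big).$$ $M(f)$ denotes multiplication: $[M(f)g](x)=f(x)g(x)$. *)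

(* Defs.v *)
From HB Require Import structures.
From mathcomp Require Import all_boot all_order all_algebra.
From mathcomp Require Import all_classical all_reals all_analysis.
From mathcomp Require Import measurable_realfun.
From mathcomp Require Import complex ring.

Set Implicit Arguments.
Unset Strict Implicit.
Unset Printing Implicit Defensive.

Import Order.TTheory GRing.Theory Num.Theory.
Import numFieldNormedType.Exports.

Local Open Scope classical_set_scope.
Local Open Scope ring_scope.
Local Open Scope complex_scope.

Local Notation Re := (@complex.Re _).
Local Notation Im := (@complex.Im _).

(** * Functions on [0, +oo[ *)

(* At an endpoint of A this is the one-sided derivative. *)
Definition has_deriv_within (R : realType) (A : set R) (f : R -> R) (t l : R) :=
  (fun x => (f x - f t) / (x - t)) @ within A t^' --> l.

Definition C1_on (R : realType) (A : set R) (f : R -> R) :=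
  exists2 f' : R -> R, {within A, continuous f'}
    & forall t, A t -> has_deriv_within A f t (f' t).

(** * Complex L^2 spaces *)

Section L2.
Context d (T : measurableType d) (R : realType).
Variable mu : {measure set T -> \bar R}.

Definition sqint : {pred T -> R[i]} := fun f =>
  (Re \o f \in Lfun mu 2%:E) && (Im \o f \in Lfun mu 2%:E).

Fact sqint_submod_closed : submod_closed sqint.
Proof.
have Z (a : R) g : g \in Lfun mu 2%:E -> (fun x => a * g x) \in Lfun mu 2%:E.
  move=> g2; have := @Lfun_scale _ _ _ mu g a 2 _ g2; rewrite ler1n => /(_ isT).
  by rewrite (_ : a \o* g = (fun x => a * g x)) //; apply/funext => x /=; rewrite mulrC.
have p1 : (1 <= 2%:E :> \bar R)%E by rewrite lee_fin ler1n.
have [L0 LD] : addr_closed (Lfun mu 2%:E) by exact: (Lfun_addr_closed mu p1).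
split=> [|a f g /andP[fr fi] /andP[gr gi]].
  by apply/andP; split; exact: L0.
have E b (h : T -> R[i]) : (Re \o (b *: h) = (fun x => Re b * Re (h x))
    + (fun x => (- Im b) * Im (h x))) /\
    (Im \o (b *: h) = (fun x => Re b * Im (h x)) + (fun x => Im b * Re (h x))).
  split; apply/funext => x /=; rewrite /GRing.scale /= /GRing.add /=;
  by case: b (h x) => [? ?] [? ?] /=; rewrite ?mulNr.
have [Er Ei] := E a f.
apply/andP; split.
- rewrite (_ : Re \o _ = (Re \o (a *: f)) + (Re \o g)); last first.
    by apply/funext => x /=; rewrite raddfD.
  by rewrite Er; apply: (LD _ _ (LD _ _ (Z _ _ fr) (Z _ _ fi)) gr).
- rewrite (_ : Im \o _ = (Im \o (a *: f)) + (Im \o g)); last first.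
    by apply/funext => x /=; rewrite raddfD.
  by rewrite Ei; apply: (LD _ _ (LD _ _ (Z _ _ fi) (Z _ _ fr)) gi).
Qed.

HB.instance Definition _ :=
  GRing.isSubmodClosed.Build _ _ sqint sqint_submod_closed.

Record sqint_fun := SqintFun { sqint_val :> T -> R[i]; _ : sqint_val \in sqint }.
HB.instance Definition _ := [isSub of sqint_fun for sqint_val].
HB.instance Definition _ := [Choice of sqint_fun by <:].
HB.instance Definition _ := [SubChoice_isSubLmodule of sqint_fun by <:].

Definition ae_null : {pred sqint_fun} := fun f =>
  `[< {ae mu, forall x, f x = 0} >].

Fact ae_null_zmod_closed : zmod_closed ae_null.
Proof.
split=> [|f g /asboolP f0 /asboolP g0]; first by apply/asboolP/nearW.
apply/asboolP; apply: filterS2 f0 g0 => x fx gx.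
by rewrite (_ : (f - g) x = f x - g x)// fx gx subrr.
Qed.

HB.instance Definition _ :=
  GRing.isZmodClosed.Build _ ae_null ae_null_zmod_closed.

Definition L2 : Type := Quotient.quot ae_null.
HB.instance Definition _ := GRing.Zmodule.on L2.
HB.instance Definition _ := EqQuotient.on L2.

Definition L2_repr (f : L2) : T -> R[i] := sqint_val (repr f).
Coercion L2_repr : L2 >-> Funclass.

Local Open Scope quotient_scope.

Lemma L2_piP (f g : sqint_fun) :
  \pi_L2 f = \pi_L2 g <-> {ae mu, forall x, f x = g x}.
Proof.
split=> [/eqP|fg].
  rewrite -Quotient.idealrBE => /asboolP; apply: filterS => x /= /eqP.
  by rewrite subr_eq0 => /eqP.
apply/eqP; rewrite -Quotient.idealrBE; apply/asboolP.
apply: filterS fg => x fgx.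
by rewrite (_ : (f - g) x = f x - g x)// fgx subrr.
Qed.

Lemma L2_piE (f : sqint_fun) : {ae mu, forall x, (\pi_L2 f : L2) x = f x}.
Proof. by apply/L2_piP; rewrite reprK. Qed.

Lemma L2P (f g : L2) : f = g <-> {ae mu, forall x, f x = g x}.
Proof. by rewrite -L2_piP !reprK. Qed.

Definition L2_scale (a : R[i]) (f : L2) : L2 := \pi_L2 (a *: repr f).

Lemma L2_scaleE a (f : L2) : {ae mu, forall x, L2_scale a f x = a * f x}.
Proof. by apply: filterS (L2_piE (a *: repr f)) => x ->. Qed.

Lemma L2_addE (f g : L2) : {ae mu, forall x, (f + g : L2) x = f x + g x}.
Proof.
have -> : f + g = \pi_L2 (repr f + repr g).
  by rewrite -{1}[f]reprK -{1}[g]reprK /L2 !piE.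
exact: L2_piE.
Qed.

Fact L2_scaleA a b (f : L2) : L2_scale a (L2_scale b f) = L2_scale (a * b) f.
Proof.
apply/L2P; apply: filterS3 (L2_scaleE a (L2_scale b f)) (L2_scaleE b f)
  (L2_scaleE (a * b) f) => x -> -> ->.
by rewrite mulrA.
Qed.

Fact L2_scale1 : left_id 1 L2_scale.
Proof.
by move=> f; apply/L2P; apply: filterS (L2_scaleE 1 f) => x ->; rewrite mul1r.
Qed.

Fact L2_scaleDr : right_distributive L2_scale +%R.
Proof.
move=> a f g; apply/L2P.
apply: filterS2 (filterI (L2_addE (L2_scale a f) (L2_scale a g)) (L2_addE f g))
  (filterI (L2_scaleE a (f + g)) (filterI (L2_scaleE a f) (L2_scaleE a g))).
by move=> x [E1 E2] [E3 [E4 E5]]; rewrite E1 E3 E2 E4 E5 mulrDr.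
Qed.

Fact L2_scaleDl f : {morph L2_scale^~ f : a b / a + b}.
Proof.
move=> a b; apply/L2P.
apply: filterS2 (L2_addE (L2_scale a f) (L2_scale b f)) (filterI
  (L2_scaleE (a + b) f) (filterI (L2_scaleE a f) (L2_scaleE b f))).
by move=> x E1 [E3 [E4 E5]]; rewrite E1 E3 E4 E5 mulrDl.
Qed.

HB.instance Definition _ := GRing.Zmodule_isLmodule.Build R[i] L2
  L2_scaleA L2_scale1 L2_scaleDr L2_scaleDl.

(* The class of f when f is square-integrable, and 0 otherwise. *)
Definition L2_class (f : T -> R[i]) : L2 := \pi_L2 (insubd (0 : sqint_fun) f).

Lemma L2_classE f : f \in sqint -> {ae mu, forall x, L2_class f x = f x}.
Proof.
move=> fs; apply: filterS (L2_piE (insubd (0 : sqint_fun) f)) => x ->.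
by rewrite -[sqint_val _]/(val _) insubdK.
Qed.

Definition Cintegral (f : T -> R[i]) : R[i] :=
  (\int[mu]_x Re (f x)) +i* (\int[mu]_x Im (f x)).

Definition L2_dot (f g : L2) : R[i] := Cintegral (fun x => f x * (g x)^*).

Definition L2_norm (f : L2) : R := Num.sqrt (Re (L2_dot f f)).

End L2.

Arguments L2_class {d T R} mu f.

(** * Linear operators *)

Section operators.
Context (R : realType).
Context d1 (T1 : measurableType d1) (mu1 : {measure set T1 -> \bar R}).
Context d2 (T2 : measurableType d2) (mu2 : {measure set T2 -> \bar R}).

Definition bounded_op (U : L2 mu1 -> L2 mu2) :=
  exists C : R, forall f, L2_norm (U f) <= C * L2_norm f.

Definition adjoint_op (U : L2 mu1 -> L2 mu2) (Us : L2 mu2 -> L2 mu1) :=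
  forall f g, L2_dot (U f) g = L2_dot f (Us g).

Definition unitary_op (U : L2 mu1 -> L2 mu2) (Us : L2 mu2 -> L2 mu1) :=
  [/\ adjoint_op U Us, cancel U Us & cancel Us U].

End operators.

(* A partially defined operator; the values of op_app outside of op_dom are
   irrelevant. *)
Record partial_op (V W : Type) := PartialOp { op_dom : set V; op_app : V -> W }.

Definition total_op (V W : Type) (f : V -> W) := PartialOp setT f.

Definition comp_op (V W X : Type) (A : partial_op W X) (B : partial_op V W) :=
  PartialOp (op_dom B `&` op_app B @^-1` op_dom A) (op_app A \o op_app B).

Definition eq_op_on (V W : Type) (D : set V) (A B : partial_op V W) :=
  forall v, D v -> [/\ op_dom A v, op_dom B v & op_app A v = op_app B v].

Definition mul_op d (T : measurableType d) (R : realType)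
    (mu : {measure set T -> \bar R}) (m : T -> R[i]) :
    partial_op (L2 mu) (L2 mu) :=
  PartialOp [set g : L2 mu | (fun x => m x * g x) \in sqint mu]
            (fun g : L2 mu => L2_class mu (fun x => m x * g x)).

Arguments mul_op {d T R mu} m.

(** * The sequence space and the discrete series *)

Notation ell2 R := (L2 (@counting nat R)).

Section discrete_series.
Variable R : realType.

Definition ell2_e (n : nat) : ell2 R := L2_class counting (fun m => (m == n)%:R).

Definition fin_span : set (ell2 R) :=
  [set v | exists N (c : nat -> R[i]), v = \sum_(n < N) c n *: ell2_e n].

(* The linear map on [fin_span] that sends [ell2_e n] to [w n]; the sum is finite
   there because the coordinate of v along [ell2_e n] is [L2_dot v (ell2_e n)]. *)
Definition lin_ext (w : nat -> ell2 R) (v : ell2 R) : ell2 R :=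
  \sum_(n \in [set: nat]) L2_dot v (ell2_e n) *: w n.

Definition slH : 'M[R[i]]_2 := \matrix_(i, j) ((i == j)%:R * (-1) ^+ i).
Definition slE : 'M[R[i]]_2 := delta_mx 0 1.
Definition slF : 'M[R[i]]_2 := delta_mx 1 0.

Lemma sl_HE : slH *m slE - slE *m slH = 2%:R *: slE.
Proof.
apply/matrixP => i j; rewrite !(mxE, big_ord_recl, big_ord0).
by case: i j => [[|[|//]] ?] [[|[|//]] ?]; rewrite /= ?expr0 ?expr1; ring.
Qed.

Lemma sl_HF : slH *m slF - slF *m slH = - 2%:R *: slF.
Proof.
apply/matrixP => i j; rewrite !(mxE, big_ord_recl, big_ord0).
by case: i j => [[|[|//]] ?] [[|[|//]] ?]; rewrite /= ?expr0 ?expr1; ring.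
Qed.

Lemma sl_EF : slE *m slF - slF *m slE = slH.
Proof.
apply/matrixP => i j; rewrite !(mxE, big_ord_recl, big_ord0).
by case: i j => [[|[|//]] ?] [[|[|//]] ?]; rewrite /= ?expr0 ?expr1; ring.
Qed.

Definition rep_H (k : R) :=
  lin_ext (fun n => (2 * (k + n%:R))%:C *: ell2_e n).
Definition rep_E (k : R) :=
  lin_ext (fun n => (Num.sqrt (n.+1%:R * (2 * k + n%:R)))%:C *: ell2_e n.+1).
(* For n = 0 the coefficient vanishes, in accordance with e_{-1} = 0. *)
Definition rep_F (k : R) :=
  lin_ext (fun n => - (Num.sqrt (n%:R * (2 * k + n%:R - 1)))%:C *: ell2_e n.-1).

(* A traceless X is X 0 0 *: slH + X 0 1 *: slE + X 1 0 *: slF. *)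
Definition pi_rep (k : R) (X : 'M[R[i]]_2) : partial_op (ell2 R) (ell2 R) :=
  PartialOp fin_span
    (fun v => X 0 0 *: rep_H k v + X 0 1 *: rep_E k v + X 1 0 *: rep_F k v).

Definition Lax (s r : R -> R) (t : R) : 'M[R[i]]_2 :=
  (s t)%:C *: slH + (r t)%:C *: (slE - slF).

End discrete_series.

Arguments ell2_e {R} n.
Arguments fin_span {R}.

(** * Laguerre polynomials *)

Section laguerre.
Variable R : realType.

Definition pochhammer (a : R) (n : nat) : R := \prod_(i < n) (a + i%:R).

Definition hyp1F1 (a b x : R) : R :=
  limn (series (fun j => pochhammer a j / (pochhammer b j * j`!%:R) * x ^+ j)).

Definition laguerre (n : nat) (alpha x : R) : R :=
  (-1) ^+ n * Num.sqrt (pochhammer (alpha + 1) n / n`!%:R) *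
  hyp1F1 (- n%:R) (alpha + 1) x.

Definition Gamma (z : R) : R :=
  \int[lebesgue_measure]_(x in `[0%R, +oo[) (x `^ (z - 1) * expR (- x)).

Definition W (k r x : R) : R :=
  x `^ (2 * k - 1) * r `^ (- (2 * k)) * expR (- x / r) / Gamma (2 * k).

Lemma W_ge0 k r x : 0 <= W k r x.
Proof.
rewrite /W divr_ge0 ?mulr_ge0 ?powR_ge0 ?expR_ge0//.
by apply: Rintegral_ge0 => y _; rewrite mulr_ge0 ?powR_ge0 ?expR_ge0.
Qed.

Lemma measurable_W k r : measurable_fun setT (W k r).
Proof.
apply: measurable_funM => //; apply: measurable_funM => //.
  by apply: measurable_funM => //; exact: measurable_powR.
apply: measurableT_comp => //; apply: measurable_funM => //.
Qed.

(* The measure W(x) dx on [0, +oo[, as a measure on R. *)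
Definition Wmeasure (k r : R) (A : set (measurableTypeR R)) : \bar R :=
  (\int[lebesgue_measure]_(x in A `&` `[0%R, +oo[) (W k r x)%:E)%E.

Section Wmeasure.
Variables k r : R.

Let Wmeasure0 : Wmeasure k r set0 = 0%E.
Proof. by rewrite /Wmeasure set0I integral_set0. Qed.

Let Wmeasure_ge0 A : (0 <= Wmeasure k r A)%E.
Proof. by apply: integral_ge0 => x _; rewrite lee_fin W_ge0. Qed.

Let Wmeasure_sigma_additive : semi_sigma_additive (Wmeasure k r).
Proof.
move=> F mF tF mUF; rewrite /Wmeasure; apply: cvg_toP.
  apply: ereal_nondecreasing_is_cvgn => m n mn.
  apply: lee_sum_nneg_natr => // j _ _; apply: integral_ge0 => x _.
  by rewrite lee_fin W_ge0.
rewrite setI_bigcupl ge0_integral_bigcup//=.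
- by move=> j; exact: measurableI.
- apply/measurable_funTS/measurableT_comp => //; exact: measurable_W.
- by move=> x _; rewrite lee_fin W_ge0.
- exact: trivIset_setIr.
Qed.

HB.instance Definition _ := isMeasure.Build _ _ _ (Wmeasure k r)
  Wmeasure0 Wmeasure_ge0 Wmeasure_sigma_additive.

End Wmeasure.

End laguerre.

Notation L2W k r := (L2 (Wmeasure k r)).

(* U is the transform determined by [U e_n](x) = L_n(x / r; 2k - 1), extended
   from the basis by linearity and boundedness. *)
Definition is_transform (R : realType) (k r : R)
    (U : {linear ell2 R -> L2W k r}) :=
  bounded_op U /\
  forall n, {ae (Wmeasure k r), forall x,
    (U (ell2_e n) : L2W k r) x = (laguerre n (2 * k - 1) (x / r))%:C}.

(* Main.v *)
(* Since (r + s)' = -2u(r + s) and -u has the sign of r, the function r + s stays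
   positive, so that (s - r)(s + r) = 0 forces r = s > 0.  With r = s the matrix of
   pi_k(L(t)) is r times the tridiagonal matrix of the three-term recurrence of the
   Laguerre polynomials, so U_t intertwines it with multiplication by x.  The same
   recurrence makes multiplication by x symmetric and tridiagonal in the functions
   L_n(x/r), and their Gram matrix is then determined by its first row, which is read
   off from the Gamma moments of W.  They are complete: a square-integrable g
   orthogonal to all polynomials has vanishing Laplace transform on the half-line
   (continued in small steps from the origin, where the exponential series converges
   in mean), so that testing against exp(-exp(m(a - x))) with m -> oo gives
   int_(x > a) g dW = 0 for every a, hence g = 0 a.e. *)

Require Import Defs.
From HB Require Import structures.
From mathcomp Require Import all_boot all_order all_algebra.
From mathcomp Require Import all_classical all_reals all_analysis.
From mathcomp Require Import measurable_realfun.
From mathcomp Require Import complex ring lra.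

Set Implicit Arguments.
Unset Strict Implicit.
Unset Printing Implicit Defensive.

Import Order.TTheory GRing.Theory Num.Theory.
Import numFieldNormedType.Exports.

Local Open Scope classical_set_scope.
Local Open Scope ring_scope.
Local Open Scope complex_scope.

Local Notation Re := (@complex.Re _).
Local Notation Im := (@complex.Im _).

Local Arguments L2_dot : simpl never.

(** * Inner product and completeness of L^2 *)

(** The passage from an orthonormal system to a unitary operator is independent of Laguerre
    polynomials: it is carried out for any complete orthonormal sequence in any [L2 mu], and rests
    on the completeness of L^2 as a metric space.

    The constants in the density argument come from one obstacle. For g in L^2(W), Cauchy-Schwarz
    makes exp(b x) g integrable only when b < 1/(2r), so exp(-z x) cannot be expanded around 0 for
    large z. Steps of length 1/(8r) stay in this range and leave room for powers of x. The double
    exponential suits this: its expansion only involves the Laplace transform at multiples of the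
    step, and the function itself is bounded by 1.

    For k < 1/2 the weight is unbounded near 0. The Gamma integrals are therefore handled on the
    open half-line, and facts about exponent a - 1 are pulled back from exponent a > 0 through
    integration by parts.

    The weighted measure lives on all of R, with no mass on the negative axis. Growth bounds are
    stated with |x| so that they hold at every point, and |x| is exchanged for x almost
    everywhere. *)

Section complex_facts.
Variable R : realType.
Implicit Types z w : R[i].

Lemma cReM z w : Re (z * w) = Re z * Re w - Im z * Im w.
Proof. by case: z w => [? ?] [? ?]. Qed.

Lemma cImM z w : Im (z * w) = Re z * Im w + Im z * Re w.
Proof. by case: z w => [? ?] [? ?]. Qed.

Lemma cReD z w : Re (z + w) = Re z + Re w. Proof. exact: raddfD. Qed.
Lemma cReB z w : Re (z - w) = Re z - Re w. Proof. exact: raddfB. Qed.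
Lemma cImB z w : Im (z - w) = Im z - Im w. Proof. exact: raddfB. Qed.

Lemma cReJ z : Re z^* = Re z. Proof. by case: z. Qed.
Lemma cImJ z : Im z^* = - Im z. Proof. by case: z. Qed.

Lemma complexP z w : Re z = Re w -> Im z = Im w -> z = w.
Proof. by case: z w => [? ?] [? ?] /= -> ->. Qed.

Lemma conjcD z w : (z + w)^* = z^* + w^* :> R[i].
Proof. by case: z w => [? ?] [? ?] /=; rewrite opprD. Qed.

Lemma conjcM z w : (z * w)^* = z^* * w^* :> R[i].
Proof. by case: z w => [? ?] [? ?] /=; apply: complexP => /=; ring. Qed.

Lemma conjcN z : (- z)^* = - z^* :> R[i].
Proof. by case: z. Qed.

(** The squared modulus as an element of [R]: the norm of [R[i]] has its values in [R[i]], which the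
    extended real integral does not accept. *)
Definition csq z : R := Re z ^+ 2 + Im z ^+ 2.

Lemma csq_ge0 z : 0 <= csq z.
Proof. by rewrite addr_ge0 ?sqr_ge0. Qed.

Lemma csq_eq0 z : csq z = 0 -> z = 0.
Proof.
move/eqP; rewrite paddr_eq0 ?sqr_ge0// !sqrf_eq0 => /andP[/eqP a /eqP b].
exact: complexP.
Qed.

End complex_facts.

Section Lfun2.
Context d (T : measurableType d) (R : realType).
Variable mu : {measure set T -> \bar R}.

Lemma Lfun2P (f : T -> R) : f \in Lfun mu 2%:E <->
  measurable_fun setT f /\ mu.-integrable setT (EFin \o (fun x => f x ^+ 2)).
Proof.
split=> [f2|[mf /integrableP[_ f2]]].
  split; last exact: Lfun2_integrable_sqr.
  by move: f2; rewrite inE => /andP[+ _]; rewrite inE.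
rewrite inE; apply/andP; split; rewrite inE//= /finite_norm unlock.
apply: poweR_lty; apply: le_lt_trans f2; apply: ge0_le_integral => //.
- move=> x _; exact: poweR_ge0.
- apply/measurable_EFinP; apply: (@measurableT_comp _ _ _ _ _ _ (fun x : R => x `^ 2)%R) => //.
  exact: measurableT_comp.
- apply: measurableT_comp => //; apply/measurable_EFinP; exact: measurable_funX.
- by move=> x _ /=; rewrite lee_fin normrX powR_mulrn.
Qed.

End Lfun2.

Section L2_inner.
Context d (T : measurableType d) (R : realType).
Variable mu : {measure set T -> \bar R}.
Implicit Types (f g h : L2 mu) (F G : T -> R[i]).

Lemma L2_sqint f : (f : T -> R[i]) \in sqint mu.
Proof. exact: valP. Qed.

Lemma sqintP F : F \in sqint mu <->
  [/\ measurable_fun setT (Re \o F), measurable_fun setT (Im \o F) &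
      (\int[mu]_x (csq (F x))%:E < +oo)%E].
Proof.
split=> [/andP[/Lfun2P[mr ir] /Lfun2P[mi ii]]|[mr mi lty]].
  split => //.
  have /integrableP[_] : mu.-integrable setT (EFin \o (fun x => csq (F x))).
    exact: integrableD ir ii.
  apply: le_lt_trans; apply: ge0_le_integral => //=.
  - by move=> x _; rewrite lee_fin csq_ge0.
  - apply/measurable_EFinP; apply: measurable_funD; exact: measurable_funX.
  - apply/measurable_EFinP; apply: measurableT_comp => //; apply: measurable_funD;
    exact: measurable_funX.
  - by move=> x _; rewrite lee_fin ler_norm.
apply/andP; split; apply/Lfun2P; split => //; apply/integrableP; split.
- apply/measurable_EFinP; exact: measurable_funX.
- apply: le_lt_trans lty; apply: ge0_le_integral => //=.
  + apply/measurable_EFinP; apply: measurableT_comp => //; exact: measurable_funX.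
  + apply/measurable_EFinP; apply: measurable_funD; exact: measurable_funX.
  + by move=> x _; rewrite lee_fin ger0_norm ?sqr_ge0// lerDl sqr_ge0.
- apply/measurable_EFinP; exact: measurable_funX.
- apply: le_lt_trans lty; apply: ge0_le_integral => //=.
  + apply/measurable_EFinP; apply: measurableT_comp => //; exact: measurable_funX.
  + apply/measurable_EFinP; apply: measurable_funD; exact: measurable_funX.
  + by move=> x _; rewrite lee_fin ger0_norm ?sqr_ge0// lerDr sqr_ge0.
Qed.

Lemma measurable_csq F : F \in sqint mu -> measurable_fun setT (fun x => csq (F x)).
Proof.
move=> /sqintP[mr mi _]; apply: measurable_funD.
  exact: (@measurable_funX _ _ _ _ (Re \o F)).
exact: (@measurable_funX _ _ _ _ (Im \o F)).
Qed.

Definition Cintegrable F :=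
  mu.-integrable setT (EFin \o (Re \o F)) /\
  mu.-integrable setT (EFin \o (Im \o F)).

Lemma sqintM F G : F \in sqint mu -> G \in sqint mu ->
  Cintegrable (fun x => F x * (G x)^*).
Proof.
move=> /andP[fr fi] /andP[gr gi].
have M a b : a \in Lfun mu 2%:E -> b \in Lfun mu 2%:E ->
    mu.-integrable setT (EFin \o (a \* b)).
  by move=> a2 b2; apply/Lfun1_integrable; exact: Lfun2_mul_Lfun1.
split.
- have := integrableD measurableT (M _ _ fr gr) (M _ _ fi gi).
  by congr (integrable _ _ _); apply/funext => x /=; rewrite cReM cReJ cImJ mulrN opprK.
- have := integrableB measurableT (M _ _ fi gr) (M _ _ fr gi).
  by congr (integrable _ _ _); apply/funext => x /=; rewrite cImM cReJ cImJ mulrN addrC.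
Qed.

Lemma CintegralD F G : Cintegrable F -> Cintegrable G ->
  Cintegral mu (fun x => F x + G x) = Cintegral mu F + Cintegral mu G.
Proof.
move=> [fr fi] [gr gi]; rewrite /Cintegral; apply: complexP => /=.
- rewrite -RintegralD//; apply: eq_Rintegral => x _; exact: raddfD.
- rewrite -RintegralD//; apply: eq_Rintegral => x _; exact: raddfD.
Qed.

Lemma CintegralZ a F : Cintegrable F ->
  Cintegral mu (fun x => a * F x) = a * Cintegral mu F.
Proof.
move=> [fr fi].
have Z b (k : T -> R) : mu.-integrable setT (EFin \o k) ->
    mu.-integrable setT (EFin \o (fun x => b * k x)).
  by move=> ki; exact: (@integrableZl _ _ _ mu _ _ b _ ki).
rewrite /Cintegral; apply: complexP.
- rewrite cReM/= -!RintegralZl// -RintegralB//; try exact: Z.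
  by apply: eq_Rintegral => x _; exact: cReM.
- rewrite cImM/= -!RintegralZl// -RintegralD//; try exact: Z.
  by apply: eq_Rintegral => x _; exact: cImM.
Qed.

Lemma Cintegral_ae_eq F G : Cintegrable F -> Cintegrable G ->
  {ae mu, forall x, F x = G x} -> Cintegral mu F = Cintegral mu G.
Proof.
move=> [fr fi] [gr gi] FG; rewrite /Cintegral /Rintegral.
congr ((fine _) +i* (fine _)); apply: ae_eq_integral => //.
- by case/integrableP : fr.
- by case/integrableP : gr.
- by apply: filterS FG => x -> _.
- by case/integrableP : fi.
- by case/integrableP : gi.
- by apply: filterS FG => x -> _.
Qed.

Lemma L2_dotM f g : Cintegrable (fun x => f x * (g x)^*).
Proof. by apply: sqintM; exact: L2_sqint. Qed.

Lemma L2_dotDl f g h : L2_dot (f + g) h = L2_dot f h + L2_dot g h.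
Proof.
rewrite /L2_dot -CintegralD; [|exact: L2_dotM|exact: L2_dotM].
apply: Cintegral_ae_eq; first exact: L2_dotM.
- have [a b] := L2_dotM f h; have [c e] := L2_dotM g h.
  split; [have := integrableD measurableT a c|have := integrableD measurableT b e];
  by congr (integrable _ _ _); apply/funext => x /=; rewrite raddfD.
- by apply: filterS (L2_addE f g) => x ->; rewrite mulrDl.
Qed.

Lemma sqint_scale a F : F \in sqint mu -> (fun x => a * F x) \in sqint mu.
Proof.
move=> Fs; have [_ /(_ a F 0 Fs)] := sqint_submod_closed mu.
have [s0 _] := sqint_submod_closed mu.
by move=> /(_ s0); rewrite addr0.
Qed.

Lemma L2_dotZl a f g : L2_dot (a *: f) g = a * L2_dot f g.
Proof.
rewrite /L2_dot -CintegralZ; last exact: L2_dotM.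
apply: Cintegral_ae_eq; first exact: L2_dotM.
- under eq_fun do rewrite mulrA.
  by apply: sqintM; [exact/sqint_scale/L2_sqint|exact: L2_sqint].
- by apply: filterS (L2_scaleE a f) => x ->; rewrite mulrA.
Qed.

Lemma L2_dotC f g : L2_dot f g = (L2_dot g f)^*.
Proof.
rewrite /L2_dot; apply: complexP => /=.
  by apply: eq_Rintegral => x _; rewrite !cReM cReJ cImJ cReJ cImJ; ring.
have [_ gi] := L2_dotM g f.
rewrite -mulN1r -RintegralZl//.
by apply: eq_Rintegral => x _; rewrite !cImM cReJ cImJ cReJ cImJ; ring.
Qed.

(** The coercion of a class to a function gives an unspecified representative; this replaces it by
    an explicit function. *)
Lemma L2_dotE f F g G : F \in sqint mu -> G \in sqint mu ->
  {ae mu, forall x, f x = F x} -> {ae mu, forall x, g x = G x} ->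
  L2_dot f g = Cintegral mu (fun x => F x * (G x)^*).
Proof.
move=> Fs Gs fF gG; apply: Cintegral_ae_eq; [exact: L2_dotM|exact: sqintM|].
by apply: filterS2 fF gG => x -> ->.
Qed.

Lemma L2_dotDr f g h : L2_dot f (g + h) = L2_dot f g + L2_dot f h.
Proof. by rewrite L2_dotC L2_dotDl conjcD (L2_dotC f g) (L2_dotC f h). Qed.

Lemma L2_dotZr a f g : L2_dot f (a *: g) = a^* * L2_dot f g.
Proof. by rewrite L2_dotC L2_dotZl conjcM (L2_dotC f g). Qed.

Lemma L2_dot0l f : L2_dot 0 f = 0.
Proof. by rewrite -(scale0r 0) L2_dotZl mul0r. Qed.

Lemma L2_dot_suml (I : Type) (r : seq I) (P : pred I) (F : I -> L2 mu) g :
  L2_dot (\sum_(i <- r | P i) F i) g = \sum_(i <- r | P i) L2_dot (F i) g.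
Proof.
apply: (big_morph (fun f => L2_dot f g)); last exact: L2_dot0l.
by move=> x y; exact: L2_dotDl.
Qed.

Lemma L2_dotNl f g : L2_dot (- f) g = - L2_dot f g.
Proof. by rewrite -scaleN1r L2_dotZl mulN1r. Qed.

Lemma L2_dotBl f g h : L2_dot (f - g) h = L2_dot f h - L2_dot g h.
Proof. by rewrite L2_dotDl L2_dotNl. Qed.

Lemma L2_dotNr f g : L2_dot f (- g) = - L2_dot f g.
Proof. by rewrite L2_dotC L2_dotNl conjcN (L2_dotC f g). Qed.

(** Estimates below are made with the squared norm, free of square roots; [L2_norm] reappears only
    where [bounded_op] is unfolded. *)
Definition nrm2 f : R := Re (L2_dot f f).

Lemma nrm2E f F : F \in sqint mu -> {ae mu, forall x, f x = F x} ->
  (nrm2 f)%:E = (\int[mu]_x (csq (F x))%:E)%E.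
Proof.
move=> Fs fF; rewrite /nrm2 (L2_dotE Fs Fs fF fF)/=.
rewrite (@eq_Rintegral _ _ _ _ _ (fun x => csq (F x))); last first.
  by move=> x _; rewrite cReM cReJ cImJ mulrN opprK -!expr2.
rewrite /Rintegral fineK// ge0_fin_numE; first by case/sqintP : Fs.
by apply: integral_ge0 => x _; rewrite lee_fin csq_ge0.
Qed.

Lemma nrm2_csq f : (nrm2 f)%:E = (\int[mu]_x (csq (f x))%:E)%E.
Proof. by apply: nrm2E; [exact: L2_sqint|exact: nearW]. Qed.

Lemma nrm2_ge0 f : 0 <= nrm2 f.
Proof.
rewrite -lee_fin nrm2_csq; apply: integral_ge0 => x _.
by rewrite lee_fin csq_ge0.
Qed.

Lemma L2_dotff f : L2_dot f f = (nrm2 f)%:C.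
Proof.
have /(congr1 Im) := L2_dotC f f; rewrite cImJ => fi.
apply: complexP => //=.
by move/eqP: fi; rewrite -subr_eq0 opprK -mulr2n mulrn_eq0/= => /eqP.
Qed.

Lemma nrm2_eq0 f : nrm2 f = 0 -> f = 0.
Proof.
move=> f0; apply/L2P.
have := nrm2_csq f; rewrite f0 => /esym i0.
have mf := measurable_csq (L2_sqint f).
have /ae_eq_integral_abs : (\int[mu]_x `|(csq (f x))%:E| = 0)%E.
  rewrite -[RHS]i0; apply: eq_integral => x _.
  by rewrite gee0_abs// lee_fin csq_ge0.
move=> /(_ measurableT) => H.
have fz : {ae mu, forall x, f x = 0}.
  apply: filterS (H _); last exact/measurable_EFinP.
  by move=> x /= /(_ I) [] /csq_eq0.
(* The chosen representative of the class 0 need not be the zero function; that it vanishes a.e. is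
   read off from 0 = 0 *: 0. *)
have z0 : {ae mu, forall x, (0 : L2 mu) x = 0}.
  have := L2_scaleE 0 (0 : L2 mu).
  rewrite -[L2_scale 0 0]/(0 *: (0 : L2 mu)) scale0r; apply: filterS => x ->.
  exact: mul0r.
by apply: filterS2 fz z0 => x -> ->.
Qed.

Lemma nrm2D f g : nrm2 (f + g) = nrm2 f + 2 * Re (L2_dot f g) + nrm2 g.
Proof.
have E : Re (L2_dot g f) = Re (L2_dot f g) by rewrite L2_dotC cReJ.
rewrite /nrm2 L2_dotDl !L2_dotDr !cReD E; ring.
Qed.

Lemma nrm2Z a f : nrm2 (a *: f) = csq a * nrm2 f.
Proof.
rewrite /nrm2 L2_dotZl L2_dotZr L2_dotff /csq !cReM !cImM cReJ cImJ/=; ring.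
Qed.

Lemma nrm2N f : nrm2 (- f) = nrm2 f.
Proof. by rewrite -scaleN1r nrm2Z /csq !raddfN/= oppr0 expr0n addr0 sqrrN expr1n mul1r. Qed.

Lemma nrm2B f g : nrm2 (f - g) = nrm2 f - 2 * Re (L2_dot f g) + nrm2 g.
Proof. by rewrite nrm2D nrm2N L2_dotNr raddfN/= mulrN. Qed.

(** The parallelogram law with the term [nrm2 (f - g)] dropped; it serves as triangle inequality for
    squared norms. *)
Lemma nrm2D_le f g : nrm2 (f + g) <= 2 * nrm2 f + 2 * nrm2 g.
Proof. have := nrm2_ge0 (f - g); rewrite nrm2B nrm2D; lra. Qed.

(* Expand [0 <= nrm2 (f - t *: g)] and take for t the minimizer. *)
Lemma L2_dot_CS f g : Re (L2_dot f g) ^+ 2 <= nrm2 f * nrm2 g.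
Proof.
have H t : 0 <= nrm2 f - 2 * t * Re (L2_dot f g) + t ^+ 2 * nrm2 g.
  have := nrm2_ge0 (f - t%:C *: g).
  by rewrite nrm2B L2_dotZr cReM nrm2Z /csq/= expr0n/= addr0 oppr0 mul0r subr0 mulrA.
have [g0|g0] := eqVneq (nrm2 g) 0.
  rewrite (nrm2_eq0 g0) L2_dotC L2_dot0l/= expr0n/= mulr_ge0 ?nrm2_ge0//.
have gp : 0 < nrm2 g by rewrite lt_neqAle eq_sym g0 nrm2_ge0.
have := H (Re (L2_dot f g) / nrm2 g).
rewrite -(pmulr_rge0 _ gp) => h; rewrite -subr_ge0; move: h; congr (_ <= _); field => //.
Qed.

Lemma L2_subE f g : {ae mu, forall x, (f - g : L2 mu) x = f x - g x}.
Proof.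
apply: filterS2 (L2_addE f (- g)) (L2_scaleE (-1) g) => x ->.
by rewrite -[L2_scale (-1) g]/(-1 *: g) scaleN1r => ->; rewrite mulN1r.
Qed.

Lemma nrm2_sub f g F G : {ae mu, forall x, f x = F x} -> {ae mu, forall x, g x = G x} ->
  measurable_fun setT (fun x => csq (F x - G x)) ->
  (nrm2 (f - g))%:E = (\int[mu]_x (csq (F x - G x))%:E)%E.
Proof.
move=> fF gG mFG; rewrite nrm2_csq; apply: ae_eq_integral => //.
- by apply/measurable_EFinP; apply: measurable_csq; exact: L2_sqint.
- exact/measurable_EFinP.
- by apply: filterS3 (L2_subE f g) fF gG => x -> -> -> _.
Qed.

Lemma sqintB F G : F \in sqint mu -> G \in sqint mu -> (fun x => F x - G x) \in sqint mu.
Proof.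
move=> Fs Gs; have [_ /(_ (-1) G F Gs Fs)] := sqint_submod_closed mu.
by congr (is_true (in_mem _ _)); apply/funext => x; rewrite scaleN1r addrC.
Qed.

Lemma sqintD F G : F \in sqint mu -> G \in sqint mu -> (fun x => F x + G x) \in sqint mu.
Proof.
move=> Fs Gs; have [_ /(_ 1 G F Gs Fs)] := sqint_submod_closed mu.
by congr (is_true (in_mem _ _)); apply/funext => x; rewrite scale1r addrC.
Qed.

Lemma measurable_csqB F G : F \in sqint mu -> G \in sqint mu ->
  measurable_fun setT (fun x => csq (F x - G x)).
Proof. by move=> Fs Gs; apply: measurable_csq; exact: sqintB. Qed.

End L2_inner.

Section completeness.
Context d (T : measurableType d) (R : realType).
Variable mu : {measure set T -> \bar R}.

(** Since M <= (M + 1)^2, the steps are at most (M + 1) 2^-j in absolute value, and the telescoping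
    series converges absolutely by comparison with a geometric one. *)
Lemma cvg_of_summable_steps (u : nat -> R) (M : R) :
  (forall j, 4 ^+ j * (u j.+1 - u j) ^+ 2 <= M) -> cvgn u.
Proof.
move=> uM; have M0 : 0 <= M by apply: le_trans (uM 0%N); rewrite mulr_ge0 ?sqr_ge0.
have ule j : `|telescope u j| <= (M + 1) * 2^-1 ^+ j.
  rewrite -(@ler_pM2l _ (2 ^+ j)) ?exprn_gt0// mulrCA -exprMn divff// expr1n mulr1.
  rewrite -[X in X * _](@ger0_norm _ (2 ^+ j)) ?exprn_ge0// -normrM.
  have M1 : 0 <= M + 1 by rewrite addr_ge0.
  rewrite -(@ler_pXn2r _ 2) ?nnegrE// real_normK ?num_real// exprMn -exprM mulnC exprM.
  rewrite (_ : 2 ^+ 2 = 4); last by rewrite -natrX.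
  apply: le_trans (uM j) _; rewrite sqrrD expr1n mulr1; nra.
have : cvgn (series (telescope u)).
  apply: normed_cvg; apply: (series_le_cvg _ _ ule) => //.
    by move=> n; rewrite mulr_ge0// addr_ge0.
  apply: is_cvg_geometric_series; rewrite ger0_norm ?invr_ge0// invf_lt1//; lra.
rewrite telescopeK => c; have : cvgn ([sequence u n - u 0%N]_n + cst (u 0%N)).
  by apply: is_cvgD => //; exact: is_cvg_cst.
by congr (cvgn _); apply/funext => n /=; rewrite /GRing.add/= subrK.
Qed.

(** A subsequence with fast decreasing steps converges pointwise almost everywhere; Fatou's lemma
    shows that its pointwise limit is the limit of the whole sequence in the mean. *)
Lemma L2_complete (x : nat -> L2 mu) :
  (forall e : R, 0 < e -> exists N, forall m n, (N <= m)%N -> (N <= n)%N ->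
     nrm2 (x m - x n) <= e) ->
  exists g, forall e : R, 0 < e -> exists N, forall n, (N <= n)%N -> nrm2 (g - x n) <= e.
Proof.
move=> xC.
have /choice[N NP] : forall j, exists N, forall m n, (N <= m)%N -> (N <= n)%N ->
    nrm2 (x m - x n) <= 8^-1 ^+ j.
  by move=> j; apply: xC; rewrite exprn_gt0.
(* [N] need not be monotone. Summing successors gives an increasing index with [N j <= M j], which
   makes the steps small, and [j <= M j], which sends it to infinity. *)
pose M j := (\sum_(i < j.+1) (N i).+1)%N.
have MS j : M j.+1 = (M j + (N j.+1).+1)%N by rewrite /M big_ord_recr.
have Mj j : (j <= M j)%N.
  elim: j => // j IH; rewrite MS addnS; exact: (leq_trans IH (leq_addr _ _)).
have MN j : (N j <= M j)%N by rewrite /M big_ord_recr/= addnS ltnW// ltnS leq_addl.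
pose y j : T -> R[i] := x (M j).
have ys j : y j \in sqint mu by exact: L2_sqint.
pose D j t := csq (y j.+1 t - y j t).
have mD k : measurable_fun setT (D k) by exact: measurable_csqB.
have D0 j t : 0 <= D j t by exact: csq_ge0.
have iD j : (\int[mu]_t (D j t)%:E <= (8^-1 ^+ j)%:E)%E.
  rewrite -(@nrm2_sub _ _ _ _ (x (M j.+1)) (x (M j)))//; [|exact: nearW|exact: nearW|exact: mD].
  by rewrite lee_fin; apply: NP => //; rewrite MS (leq_trans (MN j))// leq_addr.
(* The weight 4^j is balanced against the integrals 8^-j of [D j]: the total integral is at most the
   sum of 2^-j, while finiteness of [H t] bounds every 4^j [D j t], as [cvg_of_summable_steps]
   requires. *)
pose H t := (\sum_(0 <= j <oo) (4 ^+ j * D j t)%:E)%E.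
have mH4 j : measurable_fun setT (fun t => (4 ^+ j * D j t)%:E).
  by apply/measurable_EFinP; exact: measurable_funM.
have mH : measurable_fun setT H.
  apply: ge0_emeasurable_sum => // j t _ _; rewrite lee_fin mulr_ge0//.
have H0 t : (0 <= H t)%E by apply: nneseries_ge0 => j _ _; rewrite lee_fin mulr_ge0.
have iH : mu.-integrable setT H.
  apply/integrableP; split => //.
  under eq_integral => t _ do rewrite gee0_abs//.
  rewrite /H integral_nneseries//; last by move=> j t _; rewrite lee_fin mulr_ge0.
  apply: (@le_lt_trans _ _ (\sum_(0 <= j <oo) (2^-1 ^+ j)%:E)%E).
    apply: lee_nneseries => [j _ _|j _].
      by apply: integral_ge0 => t _; rewrite lee_fin mulr_ge0.
    under eq_integral do rewrite EFinM.
    rewrite ge0_integralZl_EFin//; [|by move=> t _; rewrite lee_fin|exact/measurable_EFinP].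
    apply: (@le_trans _ _ ((4 ^+ j)%:E * (8^-1 ^+ j)%:E)%E).
      by rewrite lee_pmul2l ?lte_fin ?exprn_gt0.
    by rewrite -EFinM -exprMn lee_fin lerXn2r// ?nnegrE; lra.
  apply: (@le_lt_trans _ _ 2%:E); last by rewrite ltry.
  apply: lime_le; first by apply: is_cvg_nneseries => j _ _; rewrite lee_fin exprn_ge0.
  apply: nearW => n; rewrite sumEFin lee_fin.
  have -> : \sum_(0 <= i < n) 2^-1 ^+ i = series (geometric 1 2^-1) n :> R.
    by apply: eq_bigr => j _ /=; rewrite mul1r.
  have h1 : `|2^-1 : R| < 1 by rewrite ger0_norm ?invr_ge0// invf_lt1//; lra.
  have h2 : (0 : R) < 2^-1 by rewrite invr_gt0.
  have := geometric_le_lim n (@ler01 R) h2 h1.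
  by have -> : 1 * (1 - 2^-1)^-1 = 2 :> R by field.
pose E := [set t | (H t < +oo)%E].
have mE : measurable E by rewrite -[E]setTI; apply: emeasurable_fun_infty_o.
(* Setting the functions to 0 off [E] makes the sequence converge at every point, so the limit is
   measurable without any completeness of [mu]. *)
pose z j t := if t \in E then y j t else 0.
have aeE : {ae mu, forall t, E t}.
  apply: filterS (integrable_ae measurableT iH) => t /(_ I).
  by rewrite ge0_fin_numE.
have zy j : {ae mu, forall t, x (M j) t = z j t}.
  by apply: filterS aeE => t Et; rewrite /z mem_set.
have mz j : measurable_fun setT (Re \o z j) /\ measurable_fun setT (Im \o z j).
  have /sqintP[mr mi _] := ys j.
  have P (p : R[i] -> R) : p 0 = 0 -> measurable_fun setT (p \o y j) -> measurable_fun setT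
    (p \o z j).
    move=> p0 mp; rewrite (_ : _ \o _ = (p \o y j) \_ E); last first.
      by apply/funext => t /=; rewrite /z patchE; case: ifP.
    by apply/(measurable_restrictT _ mE); exact: measurable_funTS.
  by split; apply: P.
have zc t : cvgn (fun j => Re (z j t)) /\ cvgn (fun j => Im (z j t)).
  have [Et|Et] := boolP (t \in E); last first.
    by rewrite /z (negbTE Et); split; exact: is_cvg_cst.
  have Hb j : 4 ^+ j * D j t <= fine (H t).
    rewrite -lee_fin fineK; last by rewrite ge0_fin_numE//; move/set_mem : Et.
    apply: le_trans (nneseries_lim_ge j.+1 _); last first.
      by move=> n _ _; rewrite lee_fin mulr_ge0.
    rewrite big_nat_recr//= leeDr// sume_ge0// => n _.
    by rewrite lee_fin mulr_ge0.
  split; apply: (@cvg_of_summable_steps _ (fine (H t))) => j; apply: le_trans (Hb j);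
    rewrite ler_pM2l ?exprn_gt0// /z Et /D /csq ?cReB ?cImB; rewrite ?lerDl ?lerDr sqr_ge0//.
pose G t := (limn (fun j => Re (z j t))) +i* (limn (fun j => Im (z j t))).
have mG : measurable_fun setT (Re \o G) /\ measurable_fun setT (Im \o G).
  split.
    by apply: (measurable_fun_cvg (fun j => (mz j).1)) => t _; exact: (zc t).1.
  by apply: (measurable_fun_cvg (fun j => (mz j).2)) => t _; exact: (zc t).2.
have mB (F F' : T -> R[i]) : measurable_fun setT (Re \o F) /\ measurable_fun setT (Im \o F) ->
    measurable_fun setT (Re \o F') /\ measurable_fun setT (Im \o F') ->
    measurable_fun setT (fun t => csq (F t - F' t)).
  move=> [a b] [a' b']; rewrite /csq; under eq_fun do rewrite ?cReB ?cImB.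
  apply: measurable_funD; apply: (@measurable_funX _ _ _ _ (fun t => _ - _));
    exact: measurable_funB.
have mx n : measurable_fun setT (Re \o x n) /\ measurable_fun setT (Im \o x n).
  by have /sqintP[? ? _] := L2_sqint (x n).
(* Fatou along j: the integrand is the pointwise limit of |z_j - x_n|^2, and the integrals are at
   most [e] as soon as [N' <= M j]. *)
have Gx (e : R) n N' : (forall m, (N' <= m)%N -> nrm2 (x m - x n) <= e) ->
    (\int[mu]_t (csq (G t - x n t))%:E <= e%:E)%E.
  move=> le_e; apply: (@le_trans _ _
      (limn_einf (fun j => \int[mu]_t (csq (z j t - x n t))%:E))%E).
    apply: (le_trans _ (fatou _ measurableT _ _)); last 2 first.
    - by move=> j; apply/measurable_EFinP; exact: mB.
    - by move=> j t _; rewrite lee_fin csq_ge0.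
    rewrite le_eqVlt; apply/orP; left; apply/eqP; apply: eq_integral => t _.
    have cR := (zc t).1; have cI := (zc t).2.
    have /cvg_limn_einf_sup[-> _] // : (fun j => (csq (z j t - x n t))%:E) @ \oo --> (csq
      (G t - x n t))%:E.
    apply: cvg_EFin; first exact: nearW.
    rewrite /csq; under [X in X @ _ --> _]eq_fun do rewrite ?cReB ?cImB.
    rewrite ?cReB ?cImB.
    by apply: cvgD; rewrite expr2; under eq_fun do rewrite expr2; apply: cvgM;
      apply: cvgB => //; exact: cvg_cst.
  rewrite limn_einf_lim; apply: lime_le.
    exact: is_cvg_einfs.
  near=> j; apply: (@le_trans _ _ (\int[mu]_t (csq (z j t - x n t))%:E)%E).
    by apply: ereal_inf_lbound; exists j => /=.
  rewrite -(@nrm2_sub _ _ _ _ (x (M j)) (x n))//; last 2 first.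
  - exact: nearW.
  - exact: mB.
  rewrite lee_fin; apply: le_e; apply: leq_trans (Mj j); near: j; exact: nbhs_infty_ge.
(* [G] is the sum of [G - x N1], square-integrable by the Fatou bound with e = 1, and of [x N1]. *)
have Gs : G \in sqint mu.
  have [N1 N1P] := xC _ ltr01.
  have := Gx 1 N1 N1 (fun m Hm => N1P m N1 Hm (leqnn _)) => i1.
  have B : (fun t => G t - x N1 t) \in sqint mu.
    apply/sqintP; split; last exact: le_lt_trans i1 (ltry _).
      rewrite (_ : _ \o _ = (Re \o G) \- (Re \o x N1)); last by apply/funext => t /=;
        rewrite raddfB.
      by apply: measurable_funB; [exact: mG.1|exact: (mx _).1].
    rewrite (_ : _ \o _ = (Im \o G) \- (Im \o x N1)); last by apply/funext => t /=; rewrite raddfB.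
    by apply: measurable_funB; [exact: mG.2|exact: (mx _).2].
  have := sqintD B (L2_sqint (x N1)).
  by congr (is_true (in_mem _ _)); apply/funext => t; rewrite subrK.
exists (L2_class mu G) => e e0; have [N1 N1P] := xC _ e0.
exists N1 => n Nn; rewrite -lee_fin (@nrm2_sub _ _ _ _ _ _ _ (x n) (L2_classE Gs));
  [|exact: nearW|exact: mB].
by apply: (Gx _ _ N1) => m Nm; exact: N1P.
Unshelve. all: by end_near. Qed.

End completeness.

(** * Orthonormal systems *)

Section orthonormal.
Context d (T : measurableType d) (R : realType).
Variable mu : {measure set T -> \bar R}.
Implicit Types (f g h : L2 mu).

(** The real inequality [L2_dot_CS] is applied after multiplying [f] by the conjugate of z = <f, g>:
    the inner product becomes |z|^2, and one factor |z|^2 cancels. *)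
Lemma csq_dot_le f g : csq (L2_dot f g) <= nrm2 f * nrm2 g.
Proof.
set z := L2_dot f g.
have := L2_dot_CS (z^*%C *: f) g; rewrite nrm2Z L2_dotZl -/z.
have -> : Re (z^*%C * z) = csq z by rewrite cReM cReJ cImJ /csq; ring.
have -> : csq z^*%C = csq z by rewrite /csq cReJ cImJ sqrrN.
have [->|z0] := eqVneq (csq z) 0; first by rewrite mulr_ge0 ?nrm2_ge0.
by rewrite expr2 -mulrA ler_pM2l// lt_neqAle eq_sym z0 csq_ge0.
Qed.

Lemma le_eps_eq0 (a b : R) : 0 <= a -> 0 <= b -> (forall e, 0 < e -> a <= e * b) -> a = 0.
Proof.
move=> a0 b0 H; apply/eqP; rewrite eq_le a0 andbT leNgt; apply/negP => ap.
have b1 : 0 < 2 * (b + 1) by lra.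
have /H := divr_gt0 ap b1.
by rewrite mulrAC ler_pdivlMr//; nra.
Qed.

Definition L2_limit (x : nat -> L2 mu) g :=
  forall e : R, 0 < e -> exists N, forall n, (N <= n)%N -> nrm2 (g - x n) <= e.

(** Continuity of the inner product, by Cauchy-Schwarz. Eventually constant inner products are all
    that occurs, since the n-th coefficient of a partial sum no longer changes beyond n. *)
Lemma L2_limit_dot x g h c N : L2_limit x g ->
  (forall n, (N <= n)%N -> L2_dot (x n) h = c) -> L2_dot g h = c.
Proof.
move=> xg xc; apply/subr0_eq/csq_eq0.
apply: (@le_eps_eq0 _ (nrm2 h)); [exact: csq_ge0|exact: nrm2_ge0|move=> e /xg[M MP]].
rewrite -(xc (maxn M N)) ?leq_maxr// -L2_dotBl.
apply: le_trans (csq_dot_le _ _) _.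
by rewrite ler_wpM2r ?nrm2_ge0// MP// leq_maxl.
Qed.

Variable phi : nat -> L2 mu.
Hypothesis phi_on : forall m n, L2_dot (phi m) (phi n) = (m == n)%:R.

Lemma dot_lincomb N (c : nat -> R[i]) n :
  L2_dot (\sum_(i < N) c i *: phi i) (phi n) = if (n < N)%N then c n else 0.
Proof.
rewrite L2_dot_suml; under eq_bigr do rewrite L2_dotZl phi_on.
case: ifPn => nN.
  rewrite (bigD1 (Ordinal nN))//= eqxx mulr1 big1 ?addr0// => i.
  by rewrite -val_eqE/= => /negPf ->; rewrite mulr0.
rewrite big1// => i _; case: eqP => [iE|_]; last by rewrite mulr0.
by move: nN; rewrite -iE ltn_ord.
Qed.

Lemma nrm2_lincomb N (c : nat -> R[i]) :
  nrm2 (\sum_(i < N) c i *: phi i) = \sum_(i < N) csq (c i).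
Proof.
set v := \sum_(i < N) _.
have : L2_dot v v = \sum_(i < N) (csq (c i))%:C.
  rewrite {1}/v L2_dot_suml; apply: eq_bigr => i _.
  rewrite L2_dotZl L2_dotC dot_lincomb ltn_ord; apply: complexP.
    by rewrite cReM cReJ cImJ /csq/=; ring.
  by rewrite cImM cReJ cImJ /=; ring.
rewrite L2_dotff -(rmorph_sum (real_complex R)) => /(congr1 Re) /=.
by [].
Qed.

(** Pythagoras: [g] and its partial sum have the same first [N] coefficients, so their difference is
    orthogonal to the partial sum. *)
Lemma nrm2_split g N c : (forall i, (i < N)%N -> L2_dot g (phi i) = c i) ->
  nrm2 g = nrm2 (g - \sum_(i < N) c i *: phi i) + \sum_(i < N) csq (c i).
Proof.
move=> gc; rewrite -nrm2_lincomb; set v := \sum_(i < N) _.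
have vv : L2_dot v v = (nrm2 v)%:C := L2_dotff v.
have E : L2_dot g v = L2_dot v v.
  rewrite L2_dotC [RHS]L2_dotC; congr (_^*); rewrite {1 3}/v !L2_dot_suml.
  apply: eq_bigr => i _; rewrite !L2_dotZl; congr (_ * _).
  by rewrite L2_dotC [RHS]L2_dotC gc// /v dot_lincomb ltn_ord.
rewrite nrm2B E vv/=; ring.
Qed.

Lemma bessel g N : \sum_(i < N) csq (L2_dot g (phi i)) <= nrm2 g.
Proof. by rewrite [leRHS](@nrm2_split g N (fun i => L2_dot g (phi i)))// lerDr nrm2_ge0. Qed.

End orthonormal.

(** * The sequence space and its standard basis *)

Section ell2_theory.
Variable R : realType.
Implicit Types f g : ell2 R.

(** A singleton has mass 1, so only the empty set is null for the counting measure: classes in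
    [ell2 R] are genuine sequences. *)
Lemma ae_counting (P : nat -> Prop) :
  {ae (@counting nat R), forall n, P n} -> forall n, P n.
Proof.
move=> [A [mA A0 PA]] n; apply: contrapT => nP.
have : (counting [set n] <= @counting nat R A)%E.
  by apply: le_measure; rewrite ?inE// => _ ->; exact: PA.
rewrite A0 /counting; case: ifPn => [_|/asboolPn[]//].
by rewrite fset_set1 finmap.cardfs1 lee_fin ler10.
Qed.

Lemma ell2_classE F n : F \in sqint (@counting nat R) -> L2_class counting F n = F n.
Proof. by move=> /L2_classE; move/ae_counting; exact. Qed.

Lemma ell2_addE f g n : (f + g : ell2 R) n = f n + g n.
Proof. exact: (ae_counting (L2_addE f g)). Qed.

Lemma ell2_scaleE a f n : (a *: f : ell2 R) n = a * f n.
Proof. exact: (ae_counting (L2_scaleE a f)). Qed.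

Lemma ell2_subE f g n : (f - g : ell2 R) n = f n - g n.
Proof. exact: (ae_counting (L2_subE f g)). Qed.

Lemma ell2_0E n : (0 : ell2 R) n = 0.
Proof. by rewrite -(scale0r 0) ell2_scaleE mul0r. Qed.

Lemma ell2P f g : (forall n, f n = g n) -> f = g.
Proof. by move=> fg; apply/L2P; exact: nearW. Qed.

Lemma integral_counting1 n (F : nat -> \bar R) :
  (\int[counting]_(m in [set n]) F m = F n)%E.
Proof.
rewrite (eq_integral (cst (F n))); last by move=> m; rewrite inE => ->.
rewrite integral_cst//= /counting; case: ifPn => [_|/asboolPn[]//].
by rewrite fset_set1 finmap.cardfs1 mule1.
Qed.

Lemma sqint_delta n : (fun m => (m == n)%:R) \in sqint (@counting nat R).
Proof.
apply/sqintP; split=> //.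
rewrite (_ : (fun m => _) = (fun m => (1%E : \bar R)) \_ [set n]).
  by rewrite -integral_mkcond integral_counting1 ltry.
apply/funext => m; rewrite patchE /csq in_set1.
by case: eqP => _; rewrite /= !expr0n ?expr1n addr0.
Qed.

Lemma ell2_eE n m : (ell2_e n : ell2 R) m = (m == n)%:R.
Proof. exact: ell2_classE (sqint_delta n). Qed.

Lemma ell2_dot_e f n : L2_dot f (ell2_e n) = f n.
Proof.
have E (p : nat -> R) : \int[counting]_m (p m * (m == n)%:R) = p n.
  rewrite /Rintegral (_ : (fun m => _) = (fun m => (p m)%:E) \_ [set n]).
    by rewrite -integral_mkcond integral_counting1.
  apply/funext => m; rewrite patchE in_set1.
  by case: eqP => _; rewrite ?mulr1 ?mulr0.
rewrite /L2_dot; apply: complexP => /=.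
  rewrite -[RHS](E (fun m => Re (f m))); apply: eq_Rintegral => m _.
  by rewrite cReM cReJ cImJ ell2_eE; case: eqP => _ /=; rewrite ?oppr0 ?mulr0 subr0.
rewrite -[RHS](E (fun m => Im (f m))); apply: eq_Rintegral => m _.
by rewrite cImM cReJ cImJ ell2_eE; case: eqP => _ /=; rewrite ?oppr0 ?mulr0 add0r.
Qed.

Lemma ell2_e_on m n : L2_dot (ell2_e m) (ell2_e n : ell2 R) = (m == n)%:R.
Proof. by rewrite ell2_dot_e ell2_eE eq_sym. Qed.

(** The squared distance is the tail of the integral of |f|^2 beyond N, which tends to 0 by
    dominated convergence. *)
Lemma ell2_e_limit f : L2_limit (fun N => \sum_(i < N) f i *: ell2_e i) f.
Proof.
have trE N n : (\sum_(i < N) f i *: ell2_e i : ell2 R) n = if (n < N)%N then f n else 0.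
  by rewrite -ell2_dot_e (dot_lincomb ell2_e_on).
have nE N : (nrm2 (f - \sum_(i < N) f i *: ell2_e i))%:E =
    (\int[counting]_n (if (n < N)%N then 0 else csq (f n))%:E)%E.
  rewrite nrm2_csq; apply: eq_integral => n _; rewrite ell2_subE trE.
  by case: ifP => _; rewrite ?subr0// subrr /csq !expr0n addr0.
have intf : (@counting nat R).-integrable setT (fun n => (csq (f n))%:E).
  apply/integrableP; split => //.
  under eq_integral do rewrite gee0_abs ?lee_fin ?csq_ge0//.
  by rewrite -nrm2_csq ltry.
have c0 : (fun N => (nrm2 (f - \sum_(i < N) f i *: ell2_e i))%:E) @ \oo --> 0%E.
  under eq_fun do rewrite nE.
  rewrite -(@integral0 _ _ _ (@counting nat R) setT).
  have [] := @dominated_convergence _ _ _ (@counting nat R) setT measurableT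
    (fun N n => (if (n < N)%N then 0 else csq (f n))%:E) (cst 0%E)
    (fun n => (csq (f n))%:E) => //.
  - apply: nearW => n _; apply: cvg_near_cst.
    by near=> N; rewrite ifT//; near: N; exact: nbhs_infty_gt.
  - apply: nearW => n N _; rewrite lee_fin; case: ifP => _.
      by rewrite normr0 csq_ge0.
    by rewrite ger0_norm ?csq_ge0.
move=> e e0.
have {c0} c0 : (fun N => nrm2 (f - \sum_(i < N) f i *: ell2_e i)) @ \oo --> (0 : R).
  by have /fine_cvgP[] := c0.
have /cvgrPdist_le/(_ e e0)[N _ NP] := c0.
exists N => n /NP /=; rewrite sub0r normrN ger0_norm ?nrm2_ge0//.
Unshelve. all: by end_near. Qed.

End ell2_theory.

(** * The unitary map of a complete orthonormal sequence *)

Section hilbert_basis.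
Context d (T : measurableType d) (R : realType).
Variable mu : {measure set T -> \bar R}.
Implicit Types (f : ell2 R) (g h : L2 mu).
Variable phi : nat -> L2 mu.
Hypothesis phi_on : forall m n, L2_dot (phi m) (phi n) = (m == n)%:R.
Hypothesis phi_complete : forall g, (forall n, L2_dot g (phi n) = 0) -> g = 0.

Lemma bounded_opP (V : ell2 R -> L2 mu) (C : R) :
  (forall f, L2_norm (V f) <= C * L2_norm f) ->
  forall f, nrm2 (V f) <= C ^+ 2 * nrm2 f.
Proof.
move=> VC f; have := VC f; rewrite /L2_norm -!/(nrm2 _) => H.
rewrite -[leLHS]sqr_sqrtr ?nrm2_ge0// -[X in _ * X]sqr_sqrtr ?nrm2_ge0// -exprMn.
by rewrite lerXn2r ?nnegrE ?sqrtr_ge0//; apply: le_trans H; rewrite sqrtr_ge0.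
Qed.

(** By orthonormality both sides are the same sum of squared coefficients; this carries the Cauchy
    property from the sequence space to [L2 mu]. *)
Lemma nrm2_partial f m n :
  nrm2 (\sum_(i < m) f i *: phi i - \sum_(i < n) f i *: phi i) =
  nrm2 (\sum_(i < m) f i *: ell2_e i - \sum_(i < n) f i *: ell2_e i).
Proof.
pose c i := (if (i < m)%N then f i else 0) - (if (i < n)%N then f i else 0).
have E (W : lmodType R[i]) (v : nat -> W) :
    \sum_(i < m) f i *: v i - \sum_(i < n) f i *: v i = \sum_(i < maxn m n) c i *: v i.
  rewrite (big_ord_widen (maxn m n) (fun i => f i *: v i) (leq_maxl m n)).
  rewrite (big_ord_widen (maxn m n) (fun i => f i *: v i) (leq_maxr m n)).
  rewrite big_mkcond [X in _ - X]big_mkcond/= -sumrB; apply: eq_bigr => i _.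
  by rewrite /c scalerBl; congr (_ - _); case: ifP => _; rewrite ?scale0r.
by rewrite !E (nrm2_lincomb phi_on) (nrm2_lincomb (@ell2_e_on R)).
Qed.

Lemma riesz_fischer f : exists g,
  L2_limit (fun N => \sum_(i < N) f i *: phi i) g /\ forall n, L2_dot g (phi n) = f n.
Proof.
have [|g gP] := @L2_complete _ _ _ mu (fun N => \sum_(i < N) f i *: phi i).
  (* Two remainders, each doubled by [nrm2D_le], have to add up to [e]. *)
  move=> e e0; have e4 : 0 < e / 4 by rewrite divr_gt0.
  have [N NP] := ell2_e_limit f e4; exists N => m n Nm Nn.
  rewrite nrm2_partial.
  set a := \sum_(i < m) _; set b := \sum_(i < n) _.
  have -> : a - b = (f - b) - (f - a) by rewrite opprB [RHS]addrC addrA subrK.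
  apply: le_trans (nrm2D_le _ _) _; rewrite nrm2N.
  have := NP _ Nm; have := NP _ Nn; rewrite -/a -/b; lra.
exists g; split=> // n; apply: (L2_limit_dot (N := n.+1) gP) => N nN.
by rewrite dot_lincomb// nN.
Qed.

(** The sum is chosen by [cid]; completeness of [phi] makes it the only vector with coefficients [f]
    ([basis_ext]), and linearity is derived from that. *)
Definition basis_map f : L2 mu := projT1 (cid (riesz_fischer f)).

Lemma basis_mapE f n : L2_dot (basis_map f) (phi n) = f n.
Proof. exact: (projT2 (cid (riesz_fischer f))).2. Qed.

Lemma basis_ext g h : (forall n, L2_dot g (phi n) = L2_dot h (phi n)) -> g = h.
Proof.
by move=> gh; apply/subr0_eq/phi_complete => n; rewrite L2_dotBl gh subrr.
Qed.

Lemma basis_map_linear : linear basis_map.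
Proof.
move=> a f g; apply: basis_ext => n.
by rewrite L2_dotDl L2_dotZl !basis_mapE ell2_addE ell2_scaleE.
Qed.

(** Bessel's inequality bounds all partial sums by [nrm2 g]. *)
Lemma sqint_coef g : (fun n => L2_dot g (phi n)) \in sqint (@counting nat R).
Proof.
apply/sqintP; split=> //.
rewrite ge0_integral_count; last by move=> n; rewrite lee_fin csq_ge0.
apply: (@le_lt_trans _ _ (nrm2 g)%:E); last by rewrite ltry.
apply: lime_le.
  by apply: is_cvg_nneseries => n _ _; rewrite lee_fin csq_ge0.
apply: nearW => N; rewrite sumEFin lee_fin big_mkord; exact: bessel.
Qed.

Definition coef_map g : ell2 R := L2_class counting (fun n => L2_dot g (phi n)).

Lemma coef_mapE g n : coef_map g n = L2_dot g (phi n).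
Proof. by rewrite /coef_map ell2_classE//; exact: sqint_coef. Qed.

Lemma coef_map_linear : linear coef_map.
Proof.
move=> a f g; apply: ell2P => n.
by rewrite ell2_addE ell2_scaleE !coef_mapE L2_dotDl L2_dotZl.
Qed.

Lemma basis_mapK : cancel basis_map coef_map.
Proof. by move=> f; apply: ell2P => n; rewrite coef_mapE basis_mapE. Qed.

Lemma coef_mapK : cancel coef_map basis_map.
Proof. by move=> g; apply: basis_ext => n; rewrite basis_mapE coef_mapE. Qed.

(** Splitting off the first N terms leaves the same sum of squared coefficients on both sides; the
    two remainders tend to 0 with N. *)
Lemma nrm2_basis_map f : nrm2 (basis_map f) = nrm2 f.
Proof.
have bl := (projT2 (cid (riesz_fischer f))).1; rewrite -/(basis_map f) in bl.
have E1 N : nrm2 (basis_map f) =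
    nrm2 (basis_map f - \sum_(i < N) f i *: phi i) + \sum_(i < N) csq (f i).
  by apply: nrm2_split => // i _; exact: basis_mapE.
have E2 N : nrm2 f = nrm2 (f - \sum_(i < N) f i *: ell2_e i) + \sum_(i < N) csq (f i).
  by apply: nrm2_split => [|i _]; [exact: ell2_e_on|exact: ell2_dot_e].
apply/eqP; rewrite eq_le; apply/andP; split; apply/ler_addgt0Pr => e e0.
  have [N NP] := bl _ e0; rewrite (E1 N) (E2 N).
  have := NP N (leqnn _); have := nrm2_ge0 (f - \sum_(i < N) f i *: ell2_e i); lra.
have [N NP] := ell2_e_limit f e0; rewrite (E1 N) (E2 N).
have := NP N (leqnn _); have := nrm2_ge0 (basis_map f - \sum_(i < N) f i *: phi i); lra.
Qed.

(* Polarization: an isometry preserves the inner product. *)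
Lemma basis_map_dot f f' : L2_dot (basis_map f) (basis_map f') = L2_dot f f'.
Proof.
have H v w : Re (L2_dot (basis_map v) (basis_map w)) = Re (L2_dot v w).
  have := nrm2_basis_map (v + w).
  have -> : basis_map (v + w) = basis_map v + basis_map w.
    by have := basis_map_linear 1 v w; rewrite !scale1r.
  rewrite !nrm2D !nrm2_basis_map; lra.
apply: complexP; first exact: H.
have := H ('i *: f) f'.
have -> : basis_map ('i *: f) = 'i *: basis_map f.
  have := basis_map_linear 'i f 0; rewrite addr0 => ->.
  by rewrite (_ : basis_map 0 = 0) ?addr0//; apply: phi_complete => n; rewrite basis_mapE ell2_0E.
by rewrite !L2_dotZl !cReM/= !mul0r !mul1r !sub0r => /oppr_inj.
Qed.

Lemma hilbert_basis_unitary : exists U : {linear ell2 R -> L2 mu},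
  [/\ bounded_op U, forall n, U (ell2_e n) = phi n,
      forall V : {linear ell2 R -> L2 mu}, bounded_op V ->
        (forall n, V (ell2_e n) = phi n) -> V =1 U
    & exists Us : {linear L2 mu -> ell2 R}, unitary_op U Us].
Proof.
pose Ul := GRing.isLinear.Build _ _ _ _ basis_map basis_map_linear.
pose U : {linear ell2 R -> L2 mu} := HB.pack basis_map Ul.
pose Usl := GRing.isLinear.Build _ _ _ _ coef_map coef_map_linear.
pose Us : {linear L2 mu -> ell2 R} := HB.pack coef_map Usl.
have Ue n : U (ell2_e n) = phi n.
  by apply: basis_ext => m; rewrite basis_mapE phi_on ell2_eE eq_sym.
exists U; split=> //.
- by exists 1 => f; rewrite mul1r /L2_norm -!/(nrm2 _) nrm2_basis_map.
- move=> V [C VC] Ve f; apply/subr0_eq/nrm2_eq0.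
  have VC' := bounded_opP VC.
  (* [V] and [U] agree on the truncation t of f, so [nrm2D_le], the bound C for V and the isometry
     of U give nrm2 (V f - U f) <= (2 C^2 + 2) nrm2 (f - t). *)
  apply: (@le_eps_eq0 _ _ (2 * C ^+ 2 + 2)).
  + exact: nrm2_ge0.
  + by rewrite addr_ge0// mulr_ge0// sqr_ge0.
  move=> e e0; have [N NP] := ell2_e_limit f e0.
  have := NP N (leqnn _); set t := \sum_(i < N) _ => tN.
  have Vt : V t = U t.
    by rewrite /t !linear_sum; apply: eq_bigr => i _; rewrite !linearZ_LR Ve Ue.
  have -> : V f - U f = V (f - t) - U (f - t).
    have -> : V (f - t) = V f - V t by exact: raddfB.
    have -> : U (f - t) = U f - U t by exact: raddfB.
    by rewrite Vt (opprB (U f)) addrA subrK.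
  apply: le_trans (nrm2D_le _ _) _; rewrite nrm2N nrm2_basis_map.
  have := VC' (f - t); have := tN; have := nrm2_ge0 (f - t).
  have := sqr_ge0 C; set n2 := nrm2 _; set nv := nrm2 _; nra.
- exists Us; split=> [f g||].
  (* Write g as U (Us g) and use that U preserves inner products. *)
  + by rewrite -[in LHS](coef_mapK g) basis_map_dot.
  + exact: basis_mapK.
  + exact: coef_mapK.
Qed.

End hilbert_basis.

(** * Gamma integrals *)

Section gamma_integrals.
Variable R : realType.
Local Notation mu := (@lebesgue_measure R).
Implicit Types a b x : R.

Definition gterm a b x : R := x `^ a * expR (- (b * x)).

Lemma gterm_ge0 a b x : 0 <= gterm a b x.
Proof. by rewrite mulr_ge0 ?powR_ge0 ?expR_ge0. Qed.

Lemma measurable_gterm a b D : measurable_fun D (gterm a b).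
Proof.
apply: measurable_funTS; apply: measurable_funM; first exact: measurable_powR.
by apply: measurableT_comp => //; apply: measurableT_comp => //; exact: measurable_funM.
Qed.

(** The single term (c x)^n / n! of the exponential series is at most its sum. *)
Lemma exprn_le_expR n c x : 0 < c -> 0 <= x -> x ^+ n <= n`!%:R / c ^+ n * expR (c * x).
Proof.
move=> c0 x0; have cx0 : 0 <= c * x by rewrite mulr_ge0// ltW.
rewrite mulrAC ler_pdivlMr ?exprn_gt0// -exprMn mulrC [c * x]mulrC.
rewrite mulrC -ler_pdivrMl ?ltr0n ?fact_gt0// mulrC [x * c]mulrC.
case: n => [|n]; first by rewrite expr0 fact0 invr1 mul1r -expR0 ler_expR.
apply: (le_trans _ (expR_ge1Dxn n cx0)); rewrite [leLHS]mulrC. by rewrite lerDr.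
Qed.

Lemma powR_le_expR a c : 0 <= a -> 0 < c -> exists2 C : R, 0 < C & forall x, 0 <= x ->
  x `^ a <= C * expR (c * x).
Proof.
move=> a0 c0; pose N := (Num.truncn a).+1.
have F0 : 0 <= N`!%:R / c ^+ N by rewrite divr_ge0// exprn_ge0// ltW.
exists (1 + N`!%:R / c ^+ N); first by rewrite ltr_pwDl.
move=> x x0; rewrite mulrDl mul1r; have [x1|x1] := leP x 1.
  have [->|xn0] := eqVneq x 0.
    rewrite mulr0 expR0 mulr1; apply: (@le_trans _ _ 1); last by rewrite lerDl.
    by rewrite /powR eqxx; case: eqP.
  have xp : 0 < x <= 1 by rewrite lt_neqAle eq_sym xn0 x0.
  apply: (@le_trans _ _ 1); first by rewrite -(powRr0 x) ger_powR.
  apply: (@le_trans _ _ (expR (c * x))); last by rewrite lerDl mulr_ge0 ?expR_ge0.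
  by rewrite -expR0 ler_expR mulr_ge0// ltW.
apply: (@le_trans _ _ (x ^+ N)).
  rewrite -(powR_mulrn _ x0); apply: ler_powR; first exact: ltW.
  by rewrite ltW// truncnS_gt.
by apply: le_trans (exprn_le_expR N c0 x0) _; rewrite lerDr expR_ge0.
Qed.

Lemma is_derive_gterm a b x : 0 < x ->
  is_derive x 1 (gterm a b) (a * gterm (a - 1) b x - b * gterm a b x).
Proof.
move=> x0.
have dp : is_derive x 1 (fun y => y `^ a) (a * x `^ (a - 1)) by exact: is_derive1_powR.
have dl : is_derive x 1 (fun y => - (b * y)) (- b).
  by apply: is_derive_eq; rewrite /GRing.scale/= mulr1.
have de : is_derive x 1 (fun y => expR (- (b * y))) (expR (- (b * x)) * - b).
  exact: is_derive1_comp.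
apply: is_derive_eq.
rewrite /gterm /GRing.scale/=; ring.
Qed.

Lemma continuous_gterm a b x : 0 < x -> {for x, continuous (gterm a b)}.
Proof.
move=> x0; apply: differentiable_continuous; apply/derivable1_diffP.
by have [] := is_derive_gterm a b x0.
Qed.

(** Half of the exponential decay absorbs the power. *)
Lemma gterm_le a b : 0 <= a -> 0 < b -> exists2 C : R, 0 < C & forall x, 0 <= x ->
  gterm a b x <= C * expR (- (b / 2 * x)).
Proof.
move=> a0 b0; have b2 : 0 < b / 2 by rewrite divr_gt0.
have [C C0 CP] := powR_le_expR a0 b2.
exists C => // x x0; rewrite /gterm.
have -> : - (b * x) = - (b / 2 * x) + - (b / 2 * x) by field.
rewrite expRD mulrA ler_pM2r ?expR_gt0// expRN ler_pdivrMr ?expR_gt0//.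
exact: CP.
Qed.

Lemma cvg_gterm0 a b : 0 < a -> 0 <= b -> gterm a b x @[x --> 0^'+] --> 0.
Proof.
move=> a0 b0; apply: (squeeze_cvgr _ (cvg_cst 0) (powR_cvg0 a0)).
near=> x; rewrite gterm_ge0/= /gterm ler_piMr ?powR_ge0//.
rewrite expR_le1 oppr_le0 mulr_ge0//.
Unshelve. all: by end_near. Qed.

Lemma cvg_gtermy a b : 0 <= a -> 0 < b -> gterm a b x @[x --> +oo] --> 0.
Proof.
move=> a0 b0; have [C C0 CP] := gterm_le a0 b0.
have b2 : 0 < b / 2 by rewrite divr_gt0.
apply: (@squeeze_cvgr _ _ _ _ (cst 0) (fun x => C * expR (- (b / 2 * x)))).
- near=> x; rewrite gterm_ge0/=; apply: CP; near: x; exact: nbhs_pinfty_ge.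
- exact: cvg_cst.
rewrite -(mulr0 C); apply: cvgMr.
apply: (@cvg_comp _ _ _ (fun x => b / 2 * x) (fun y => expR (- y)) _ (pinfty_nbhs R));
  last exact: cvgr_expR.
exact: gt0_cvgMry.
Unshelve. all: by end_near. Qed.

(** For a > -1 and b > 0 this is Gamma(a + 1) / b^(a + 1). It is extended real because its
    finiteness for negative exponents is itself deduced from identities between such integrals. *)
Definition gint a b : \bar R := (\int[mu]_(x in `]0%R, +oo[) (gterm a b x)%:E)%E.

Lemma gint_ge0 a b : (0 <= gint a b)%E.
Proof. by apply: integral_ge0 => x _; rewrite lee_fin gterm_ge0. Qed.

Lemma integral_expRN b : 0 < b -> (\int[mu]_(x in `[0%R, +oo[) (expR (- (b * x)))%:E = b^-1%:E)%E.
Proof.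
move=> b0; have := integral_exponential_pdf b0.
rewrite -[X in integral _ _ X]/(EFin \o exponential_pdf b) /exponential_pdf -restrict_EFin.
rewrite -integral_mkcond /=.
under eq_integral do rewrite EFinM mulNr.
rewrite ge0_integralZl//.
- move=> /(congr1 (fun z => (b^-1)%:E * z)%E).
  by rewrite muleA -EFinM mulVf ?gt_eqF// mul1e mule1.
- apply/measurable_EFinP/measurable_funTS.
  by apply: measurableT_comp => //; apply: measurableT_comp => //; exact: measurable_funM.
- by rewrite lee_fin ltW.
Qed.

Lemma gint_fin_ge0 a b : 0 <= a -> 0 < b -> (gint a b < +oo)%E.
Proof.
move=> a0 b0; have [C C0 CP] := gterm_le a0 b0.
have b2 : 0 < b / 2 by rewrite divr_gt0.
apply: (@le_lt_trans _ _ (\int[mu]_(x in `[0%R, +oo[) (C%:E * (expR (- (b / 2 * x)))%:E))%E).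
  rewrite /gint integral_itv_obnd_cbnd; last by apply/measurable_EFinP; exact: measurable_gterm.
  apply: ge0_le_integral => //.
  - by move=> x _; rewrite lee_fin gterm_ge0.
  - by apply/measurable_EFinP; exact: measurable_gterm.
  - apply/measurable_EFinP/measurable_funTS; apply: measurable_funM => //.
    by apply: measurableT_comp => //; apply: measurableT_comp => //; exact: measurable_funM.
  - by move=> x; rewrite /= in_itv/= andbT => x0; rewrite lee_fin CP.
rewrite ge0_integralZl//.
- by rewrite integral_expRN// -EFinM ltry.
- apply/measurable_EFinP/measurable_funTS.
  by apply: measurableT_comp => //; apply: measurableT_comp => //; exact: measurable_funM.
- by rewrite lee_fin ltW.
Qed.

(* Integration by parts on compact subintervals of ]0, +oo[, then a monotone limit. *)
Lemma gint_rec a b : 0 < a -> 0 < b -> (a%:E * gint (a - 1) b = b%:E * gint a b)%E.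
Proof.
move=> a0 b0.
(* The shift by 2 gives l n < 1 < u n for every n, so each interval is nondegenerate. *)
pose l n : R := n.+2%:R^-1; pose u n : R := n.+2%:R.
pose F n := `[l n, u n]%classic.
have l0 n : 0 < l n by rewrite invr_gt0.
have lu n : l n < u n.
  by apply: (@lt_trans _ _ 1); rewrite ?invf_lt1// ltr1n.
have Fpos n x : x \in `[l n, u n] -> 0 < x.
  by rewrite in_itv/= => /andP[+ _]; apply: lt_le_trans.
have mF n : measurable (F n) by exact: measurable_itv.
have cF c n : {within F n, continuous (gterm c b)}.
  by apply: continuous_in_subspaceT => x /set_mem/Fpos; exact: continuous_gterm.
have iF c n : mu.-integrable (F n) (EFin \o gterm c b).
  by apply: continuous_compact_integrable; [exact: segment_compact|exact: cF].
have E n : (a%:E * \int[mu]_(x in F n) (gterm (a - 1) b x)%:E =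
    b%:E * \int[mu]_(x in F n) (gterm a b x)%:E + (gterm a b (u n) - gterm a b (l n))%:E)%E.
  pose f x := a * gterm (a - 1) b x - b * gterm a b x.
  have cc : {within F n, continuous f}.
    apply: continuous_in_subspaceT => x /set_mem/Fpos x0.
    by apply: cvgB; apply: cvgMr; exact: continuous_gterm.
  have dd : derivable_oo_LRcontinuous (gterm a b) (l n) (u n).
    split.
    + move=> x; rewrite in_itv/= => /andP[lx _].
      by have [] := is_derive_gterm a b (lt_trans (l0 n) lx).
    + by apply: cvg_at_right_filter; exact: continuous_gterm.
    + by apply: cvg_at_left_filter; exact: continuous_gterm (lt_trans (l0 n) (lu n)).
  have ee : {in `]l n, u n[, derive1 (gterm a b) =1 f}.
    move=> x; rewrite in_itv/= => /andP[lx _].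
    by rewrite derive1E; have [_ ->] := is_derive_gterm a b (lt_trans (l0 n) lx).
  rewrite EFinB -(continuous_FTC2 (lu n) cc dd ee) -/(F n) /f.
  under [X in (_ = _ + X)%E]eq_integral do rewrite EFinB (EFinM a) (EFinM b).
  have ia := @integrableZl _ _ _ mu _ (mF n) a _ (iF (a - 1) n).
  have ib := @integrableZl _ _ _ mu _ (mF n) b _ (iF a n).
  have fb := @integrable_fin_num _ _ _ mu _ (mF n) _ (iF a n).
  rewrite (@integralB _ _ _ mu _ (mF n) _ _ ia ib)
    (@integralZl _ _ _ mu _ (mF n) _ (iF (a - 1) n)) (@integralZl _ _ _ mu _ (mF n) _ (iF a n)).
  by rewrite [RHS]addeC subeK// fin_numM.
have U : (\bigcup_n F n = `]0%R, +oo[)%classic.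
  apply/seteqP; split => x /=.
    by move=> [n _ /Fpos x0]; rewrite in_itv/= x0.
  rewrite in_itv/= andbT => x0.
  have [n nP] : exists n, Num.max x x^-1 <= n.+2%:R.
    exists (Num.truncn (Num.max x x^-1)); rewrite ltW// (lt_trans (truncnS_gt _))// ltr_nat//.
  exists n => //; rewrite /F/= in_itv/=; move: nP; rewrite ge_max => /andP[xn ixn].
  by rewrite xn andbT /l invf_ple// posrE.
have nd : nondecreasing_seq F.
  move=> m n mn; rewrite subsetEset; apply: subset_itv; rewrite bnd_simp.
    by rewrite /l lef_pV2 ?posrE// ler_nat.
  by rewrite /u ler_nat.
have cv c : (\int[mu]_(x in F n) (gterm c b x)%:E)%E @[n --> \oo] --> gint c b.
  rewrite /gint -U; apply: ge0_nondecreasing_set_cvg_integral => //.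
  - by move=> n; apply/measurable_EFinP; exact: measurable_gterm.
  - by move=> n x _; rewrite lee_fin gterm_ge0.
have uy : u n @[n --> \oo] --> +oo.
  apply/cvgryPge => A; near=> n; apply: (@le_trans _ _ n%:R).
    by near: n; exact: nbhs_infty_ger.
  by rewrite /u ler_nat ltnW.
have u0 : l n @[n --> \oo] --> 0.
  by apply/gtr0_cvgV0 => //; apply: nearW => n; rewrite /u ltr0n.
(* One sequence, two limits: directly by monotone exhaustion, and through [E], where the boundary
   terms vanish because 0 < a and 0 < b. The limits are taken in [\bar R], as finiteness of
   [gint (a - 1) b] is not yet known. *)
have c1 : (a%:E * \int[mu]_(x in F n) (gterm (a - 1) b x)%:E)%E @[n --> \oo] -->
  (a%:E * gint (a - 1) b)%E.
  by apply: cvgeZl.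
have c2 : (a%:E * \int[mu]_(x in F n) (gterm (a - 1) b x)%:E)%E @[n --> \oo] -->
  (b%:E * gint a b + 0)%E.
  under [X in X @ _ --> _]eq_fun do rewrite E.
  apply: cvgeD; first by rewrite fin_num_adde_defl.
    exact: cvgeZl.
  apply: cvg_EFin; first exact: nearW.
  rewrite -[X in _ --> X](subrr 0); apply: cvgB.
    exact: (@cvg_comp _ _ _ u (gterm a b) _ (pinfty_nbhs R) _ uy (cvg_gtermy (ltW a0) b0)).
  by apply: ((cvg_at_rightP _ _ _).1 (cvg_gterm0 a0 (ltW b0)) l); split.
by rewrite (cvg_unique _ c1 c2) // adde0.
Unshelve. all: by end_near. Qed.

(** For a < 1 the integrand is unbounded near 0, out of reach of [gterm_le]; an infinite value
    would, by [gint_rec], make [gint a b] infinite too. *)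
Lemma gint_fin a b : 0 < a -> 0 < b -> (gint (a - 1) b < +oo)%E.
Proof.
move=> a0 b0; rewrite ltey; apply/eqP => E.
have := gint_rec a0 b0; rewrite E mulry gtr0_sg// mul1e => /esym/eqP.
apply/negP; rewrite -ltey; apply: lte_mul_pinfty => //; first by rewrite lee_fin ltW.
exact: gint_fin_ge0 (ltW a0) b0.
Qed.

(** The substitution y = b x is made at exponent a, where the integrand is continuous up to 0;
    [gint_rec] for the rates b and 1 then lowers the exponent. *)
Lemma gint_scale a b : 0 < a -> 0 < b ->
  (gint (a - 1) b = (b `^ (- a))%:E * gint (a - 1) 1)%E.
Proof.
move=> a0 b0.
have dF (x : R) : is_derive x 1 (fun y : R => b * y) b.
  by apply: is_derive_eq; rewrite /GRing.scale/= mulr1.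
have dFE : derive1 (fun y : R => b * y) = cst b.
  by apply/funext => x; rewrite derive1E; have [_ ->] := dF x.
have gint_cy c d : gint c d = (\int[mu]_(x in `[0%R, +oo[) (gterm c d x)%:E)%E.
  rewrite /gint integral_itv_obnd_cbnd//; apply/measurable_EFinP; exact: measurable_gterm.
have H : (gint a 1 = (b `^ a * b)%:E * gint a b)%E.
  rewrite !gint_cy -{1}(mulr0 b).
  rewrite (@increasing_ge0_integration_by_substitutiony _ (fun y => b * y) (gterm a 1) 0).
  - rewrite -ge0_integralZl//=.
    + apply: eq_integral => x; rewrite inE/= in_itv/= andbT => x0.
      rewrite -EFinM; congr (_%:E).
      change (gterm a 1 (b * x) * derive1 (fun y : R => b * y) x = b `^ a * b * gterm a b x).
      rewrite dFE /gterm powRM// ?(ltW b0)// mul1r/=; ring.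
    + apply/measurable_EFinP; exact: measurable_gterm.
    + by move=> x _; rewrite lee_fin gterm_ge0.
    + by rewrite lee_fin mulr_ge0 ?powR_ge0// ltW.
  - by move=> x y _ _ xy; rewrite ltr_pM2l.
  - by move=> x _; rewrite dFE; exact: cvg_cst.
  - by rewrite dFE; exact: is_cvg_cst.
  - by rewrite dFE; exact: is_cvg_cst.
  - split; first by move=> x _; have [] := dF x.
    by apply: cvg_at_right_filter; apply: cvgMr; exact: cvg_id.
  - exact: gt0_cvgMry.
  - rewrite mulr0; apply/continuous_within_itvcyP; split.
      by move=> x; rewrite in_itv/= andbT; exact: continuous_gterm.
    by rewrite {2}/gterm powR0 ?gt_eqF// mul0r; exact: cvg_gterm0.
  - by move=> x _; exact: gterm_ge0.
have E1 := gint_rec a0 b0; have E2 := gint_rec a0 ltr01.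
have f1 := gint_fin a0 b0; have f2 := gint_fin a0 ltr01.
have f3 := gint_fin_ge0 (ltW a0) b0; have f4 := gint_fin_ge0 (ltW a0) ltr01.
have g1 := gint_ge0 (a - 1) b; have g2 := gint_ge0 (a - 1) 1.
have g3 := gint_ge0 a b; have g4 := gint_ge0 a 1.
move: H E1 E2 f1 f2 f3 f4 g1 g2 g3 g4.
move: (gint a 1) (gint a b) (gint (a - 1) 1) (gint (a - 1) b).
move=> [w| |] [z| |] [y| |] [x| |] //=; rewrite -!EFinM => -[H] [E1] [E2] _ _ _ _ _ _ _ _.
congr (_%:E); apply: (mulfI (lt0r_neq0 a0)); rewrite E1 mulrCA E2 mul1r H.
rewrite powRN; field.
by rewrite gt_eqF// powR_gt0.
Qed.

Lemma gint_gt0 a : 0 < a -> (0 < gint (a - 1) 1)%E.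
Proof.
move=> a0; have : (0 < gint a 1)%E.
  apply: (@lt_le_trans _ _ (\int[mu]_(x in `[1%R, 2%R]) (expR (- 2))%:E)%E).
    rewrite integral_cst//= lebesgue_measure_itv/= lte_fin ltr1n -EFinB -EFinM lte_fin.
    by rewrite mulr_gt0 ?expR_gt0// subr_gt0 ltr1n.
  apply: (@le_trans _ _ (\int[mu]_(x in `[1%R, 2%R]) (gterm a 1 x)%:E)%E).
    apply: ge0_le_integral => //.
    - by apply/measurable_EFinP; exact: measurable_gterm.
    - move=> x; rewrite /= in_itv/= => /andP[x1 x2]; rewrite lee_fin /gterm mul1r.
      rewrite -[leLHS]mul1r ler_pM ?expR_ge0 ?ler_expR ?lerN2//.
      by rewrite -(powRr0 x) ler_powR// ltW.
  apply: ge0_subset_integral => //.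
  - by apply/measurable_EFinP; exact: measurable_gterm.
  - by move=> x _; rewrite lee_fin gterm_ge0.
  - move=> x; rewrite /= !in_itv/= andbT => /andP[x1 _]; exact: lt_le_trans x1.
move: (gint_rec a0 ltr01); rewrite mul1e => <-.
by rewrite pmule_rgt0 ?lte_fin.
Qed.

(** [Gamma] is a real integral, which would turn an infinite value into 0; finiteness of [gint] is
    the content here. *)
Lemma Gamma_gint a : 0 < a -> (Gamma a)%:E = gint (a - 1) 1.
Proof.
move=> a0; rewrite /Gamma /Rintegral /gint integral_itv_obnd_cbnd; last first.
  by apply/measurable_EFinP; exact: measurable_gterm.
have -> : (\int[mu]_(x in `[0%R, +oo[) (x `^ (a - 1) * expR (- x))%:E =
    \int[mu]_(x in `[0%R, +oo[) (gterm (a - 1) 1 x)%:E)%E.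
  by apply: eq_integral => x _; rewrite /gterm mul1r.
rewrite fineK// ge0_fin_numE; last by apply: integral_ge0 => x _; rewrite lee_fin gterm_ge0.
rewrite -integral_itv_obnd_cbnd; last by apply/measurable_EFinP; exact: measurable_gterm.
exact: gint_fin.
Qed.

Lemma Gamma_gt0 a : 0 < a -> 0 < Gamma a.
Proof. by move=> a0; rewrite -lte_fin Gamma_gint// gint_gt0. Qed.

End gamma_integrals.

(** * Integration against a measure with a density *)

Section density.
Context d (T : measurableType d) (R : realType).
Variables (mu nu : {measure set T -> \bar R}) (w : T -> R).
Hypothesis mw : measurable_fun setT w.
Hypothesis w0 : forall x, 0 <= w x.
Hypothesis nuE : forall A, measurable A -> nu A = (\int[mu]_(x in A) (w x)%:E)%E.

Import HBNNSimple.

(** For indicators this is [nuE], for simple functions it follows by linearity, and in general by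
    monotone convergence on both sides along one simple approximation. *)
Lemma ge0_integral_density (f : T -> R) : (forall x, 0 <= f x) -> measurable_fun setT f ->
  (\int[nu]_x (f x)%:E = \int[mu]_x (f x * w x)%:E)%E.
Proof.
move=> f0 mf; have mEf : measurable_fun setT (EFin \o f) by exact/measurable_EFinP.
pose h := nnsfun_approx measurableT mEf.
have hf x : (fun n => (h n x)%:E) @ \oo --> (f x)%:E.
  exact: (@cvg_nnsfun_approx _ _ _ _ measurableT _ mEf (fun y _ => (f0 y : (0 <= (f y)%:E)%E)) x I).
have hnd x : {homo (fun n => h n x) : m n / (m <= n)%N >-> m <= n}.
  by move=> m n mn; exact/lefP/nd_nnsfun_approx.
have mh n : measurable_fun setT (h n) by exact: measurable_funP.
have -> : (\int[nu]_x (f x)%:E = limn (fun n => \int[nu]_x (h n x)%:E))%E.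
  rewrite -monotone_convergence//.
  - by apply: eq_integral => x _; apply/esym/cvg_lim => //; exact: hf.
  - by move=> n; exact/measurable_EFinP.
  - by move=> n x _; rewrite lee_fin.
  - by move=> x _ m n mn; rewrite lee_fin; exact: hnd.
have -> : (\int[mu]_x (f x * w x)%:E = limn (fun n => \int[mu]_x (h n x * w x)%:E))%E.
  rewrite -monotone_convergence//.
  - apply: eq_integral => x _; apply/esym/cvg_lim => //; rewrite EFinM.
    under eq_fun do rewrite EFinM.
    by apply: cvgeZr => //; exact: hf.
  - by move=> n; apply/measurable_EFinP; exact: measurable_funM.
  - by move=> n x _; rewrite lee_fin mulr_ge0.
  - by move=> x _ m n mn; rewrite lee_fin ler_wpM2r//; exact: hnd.
congr (limn _); apply/funext => n.
have hE x : h n x = \sum_(y \in range (h n)) y * \1_(h n @^-1` [set y]) x by rewrite {1}fimfunE.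
have ind y : measurable (h n @^-1` [set y]) by exact: measurable_sfunP.
have y0 y : y \in range (h n) -> 0 <= y by move=> /set_mem[x _ <-].
transitivity (\sum_(y \in range (h n)) \int[nu]_x (y * \1_(h n @^-1` [set y]) x)%:E)%E.
  rewrite -ge0_integral_fsum//.
  - by apply: eq_integral => x _; rewrite hE -fsumEFin.
  - by move=> y; apply/measurable_EFinP; exact: measurable_funM.
  - move=> y x _; exact: nnfun_muleindic_ge0.
transitivity (\sum_(y \in range (h n)) \int[mu]_x (y * \1_(h n @^-1` [set y]) x * w x)%:E)%E;
  last first.
  rewrite -ge0_integral_fsum//.
  - apply: eq_integral => x _; rewrite EFinM hE -fsumEFin// ge0_mule_fsuml//.
    by move=> y; exact: nnfun_muleindic_ge0.
  - by move=> y; apply/measurable_EFinP; apply: measurable_funM => //; exact: measurable_funM.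
  - move=> y x _; rewrite EFinM mule_ge0 ?lee_fin//; exact: nnfun_muleindic_ge0.
apply: eq_fsbigr => y /y0 yy.
under [RHS]eq_integral do rewrite -mulrA EFinM.
under eq_integral do rewrite EFinM.
rewrite !ge0_integralZl ?lee_fin//.
- rewrite integral_indic// setIT nuE//.
  congr (_ * _)%E; rewrite integral_mkcond; apply: eq_integral => x _.
  by rewrite patchE indicE; case: ifP => _ /=; rewrite ?mul1r ?mul0r.
- by apply/measurable_EFinP; exact: measurable_funM.
- by move=> x _; rewrite lee_fin mulr_ge0.
- by apply/measurable_EFinP.
Qed.

End density.

(** * Laguerre polynomials and the weight *)

Section laguerre_recurrence.
Variable R : realType.
Implicit Types (b y : R) (n : nat).

Lemma pochhammerS b n : pochhammer b n.+1 = pochhammer b n * (b + n%:R).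
Proof. by rewrite /pochhammer big_ord_recr. Qed.

Lemma pochhammer0 b : pochhammer b 0 = 1.
Proof. by rewrite /pochhammer big_ord0. Qed.

Lemma pochhammer_gt0 b n : 0 < b -> 0 < pochhammer b n.
Proof. by move=> b0; apply: prodr_gt0 => i _; rewrite ltr_wpDr. Qed.

Lemma pochhammer_opp n j : pochhammer (- n%:R : R) j = (-1) ^+ j * (n ^_ j)%:R.
Proof.
elim: j => [|j IH]; first by rewrite pochhammer0 mul1r.
rewrite pochhammerS IH ffactnSr exprSr natrM -!mulrA; congr (_ * _).
have [jn|nj] := leqP j n; first by rewrite natrB//; ring.
by rewrite ffact_small// !mul0r mulr0.
Qed.

(** The terminating series 1F1(-n; b; y), rewritten with (-n)_j / j! = (-1)^j C(n, j). *)
Definition kummer b n y : R :=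
  \sum_(j < n.+1) (-1) ^+ j * 'C(n, j)%:R / pochhammer b j * y ^+ j.

Lemma kummer_widen b n N y : (n < N)%N ->
  kummer b n y = \sum_(j < N) (-1) ^+ j * 'C(n, j)%:R / pochhammer b j * y ^+ j.
Proof.
move=> nN; rewrite /kummer.
rewrite (big_ord_widen N (fun j => (-1) ^+ j * 'C(n, j)%:R / pochhammer b j * y ^+ j) nN).
rewrite big_mkcond/=; apply: eq_bigr => j _; case: ltnP => // nj.
by rewrite bin_small// mulr0 !mul0r.
Qed.

Lemma hyp1F1_kummer b n y : 0 < b -> hyp1F1 (- n%:R) b y = kummer b n y.
Proof.
move=> b0; have bn j : pochhammer b j != 0 by rewrite gt_eqF// pochhammer_gt0.
have fn j : (j`!%:R : R) != 0 by rewrite pnatr_eq0 -lt0n fact_gt0.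
have E m : (n < m)%N ->
    series (fun j => pochhammer (- n%:R) j / (pochhammer b j * j`!%:R) * y ^+ j) m = kummer b n y.
  move=> nm; rewrite (kummer_widen _ _ nm) seriesEnat/= big_mkord.
  apply: eq_bigr => j _; congr (_ * _); rewrite pochhammer_opp -bin_ffact natrM.
  by field; rewrite bn fn.
apply/cvg_lim => //; apply: cvg_near_cst; near=> m; rewrite E//.
by near: m; exact: nbhs_infty_gt.
Unshelve. all: by end_near. Qed.

(** A contiguous relation, proved by comparing coefficients of each power of y. At n = 0 the index
    [n.-1] is again 0, but its term carries the factor n = 0. *)
Lemma kummer_rec b n y : 0 < b ->
  y * kummer b n y =
  (2 * n%:R + b) * kummer b n y - (b + n%:R) * kummer b n.+1 y - n%:R * kummer b n.-1 y.
Proof.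
move=> b0; have bn j : pochhammer b j != 0 by rewrite gt_eqF// pochhammer_gt0.
have -> : y * kummer b n y = \sum_(j < n.+3)
   (if j == 0%N :> nat then 0 else (-1) ^+ j.-1 * 'C(n, j.-1)%:R / pochhammer b j.-1 * y ^+ j).
  rewrite big_ord_recl/= add0r (@kummer_widen _ _ n.+2)// mulr_sumr.
  by apply: eq_bigr => j _; rewrite /bump/= add1n/= exprS; ring.
have w1 : (n < n.+3)%N by rewrite ltnW.
have w2 : (n.+1 < n.+3)%N by [].
rewrite (kummer_widen _ _ w1) (kummer_widen _ _ w2)
  (kummer_widen _ _ (leq_ltn_trans (leq_pred n) w1)).
rewrite !mulr_sumr -!sumrB; apply: eq_bigr => -[j /= _] _.
case: j => [|j] /=.
  rewrite !bin0 pochhammer0; ring.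
(* Over the common denominator (b)_(j+1) the comparison reduces to the binomial identity [key]. *)
have -> : (-1) ^+ j * 'C(n, j)%:R / pochhammer b j * y ^+ j.+1 =
   - ((-1) ^+ j.+1 * ((b + j%:R) * 'C(n, j)%:R) / pochhammer b j.+1 * y ^+ j.+1).
  rewrite pochhammerS !exprS; field.
  by rewrite bn /= gt_eqF// ltr_wpDr.
have key : (b + n%:R) * 'C(n.+1, j.+1)%:R =
    (2 * n%:R + b) * 'C(n, j.+1)%:R + (b + j%:R) * 'C(n, j)%:R - n%:R * 'C(n.-1, j.+1)%:R :> R.
  (* Truncated subtraction is harmless beside a binomial coefficient, which vanishes when i > m. *)
  have R1 m i : (m%:R - i%:R) * 'C(m, i)%:R = (m - i)%:R * 'C(m, i)%:R :> R.
    have [im|mi] := leqP i m; first by rewrite natrB.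
    by rewrite bin_small// !mulr0.
  have h1 := congr1 (fun m => m%:R : R) (mul_bin_down n j.+1).
  have h2 := congr1 (fun m => m%:R : R) (mul_bin_left n j).
  rewrite /= !natrM -R1 in h1; rewrite /= !natrM -R1 in h2.
  rewrite binS natrD h1; move: h2; rewrite -[j.+1]addn1 natrD; lra.
transitivity ((-1) ^+ j.+1 / pochhammer b j.+1 * y ^+ j.+1 *
  ((2 * n%:R + b) * 'C(n, j.+1)%:R - (b + n%:R) * 'C(n.+1, j.+1)%:R
    - n%:R * 'C(n.-1, j.+1)%:R)); last by ring.
by rewrite key; ring.
Qed.

Definition lagnorm b n : R := Num.sqrt (pochhammer b n / n`!%:R).

(** Passing from the norm at n to the norm at n + 1 replaces b + n by the geometric mean of n + 1
    and b + n; with [lagnorm_down] this makes the recurrence symmetric. *)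
Lemma lagnorm_up b n : 0 < b ->
  lagnorm b n * (b + n%:R) = Num.sqrt (n.+1%:R * (b + n%:R)) * lagnorm b n.+1.
Proof.
move=> b0; have bn : 0 < b + n%:R by rewrite ltr_wpDr.
have p0 m : 0 <= pochhammer b m / m`!%:R by rewrite divr_ge0// ltW// pochhammer_gt0.
rewrite /lagnorm -[X in _ * X = _](ger0_norm (ltW bn)) -sqrtr_sqr -!sqrtrM ?p0 ?sqr_ge0
  ?(mulr_ge0 _ (ltW bn))//.
congr Num.sqrt; rewrite pochhammerS factS natrM; field.
by rewrite nat1r !pnatr_eq0 -lt0n fact_gt0.
Qed.

Lemma lagnorm_down b n : 0 < b ->
  lagnorm b n * n%:R = Num.sqrt (n%:R * (b + n%:R - 1)) * lagnorm b n.-1.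
Proof.
move=> b0; case: n => [|n]; first by rewrite !mul0r sqrtr0 mulr0 mul0r.
have p0 m : 0 <= pochhammer b m / m`!%:R by rewrite divr_ge0// ltW// pochhammer_gt0.
have -> : b + n.+1%:R - 1 = b + n%:R by rewrite -natr1; ring.
have bn : 0 < b + n%:R by rewrite ltr_wpDr.
rewrite /lagnorm -[X in _ * X = _](ger0_norm (ler0n R n.+1)) -sqrtr_sqr -!sqrtrM ?p0 ?sqr_ge0
  ?(mulr_ge0 _ (ltW bn))//.
congr Num.sqrt; rewrite /= pochhammerS factS natrM; field.
by rewrite nat1r !pnatr_eq0 -lt0n fact_gt0.
Qed.

Lemma laguerreE n a y : 0 < a + 1 ->
  laguerre n a y = (-1) ^+ n * lagnorm (a + 1) n * kummer (a + 1) n y.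
Proof. by move=> a0; rewrite /laguerre hyp1F1_kummer. Qed.

Lemma laguerre0 a y : 0 < a + 1 -> laguerre 0 a y = 1.
Proof.
move=> a0; rewrite laguerreE// /lagnorm /kummer big_ord_recl big_ord0 pochhammer0 bin0.
by rewrite fact0 divr1 sqrtr1 !expr0 addr0 invr1 !mulr1.
Qed.

Lemma laguerre_rec n a y : 0 < a + 1 ->
  y * laguerre n a y =
  Num.sqrt (n.+1%:R * (a + 1 + n%:R)) * laguerre n.+1 a y +
  (2 * n%:R + (a + 1)) * laguerre n a y +
  Num.sqrt (n%:R * (a + 1 + n%:R - 1)) * laguerre n.-1 a y.
Proof.
move=> a0; rewrite !laguerreE// mulrCA kummer_rec//.
have h1 := lagnorm_up n a0; have h2 := lagnorm_down n a0.
set b := a + 1 in a0 h1 h2 *.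
transitivity ((-1) ^+ n * ((2 * n%:R + b) * lagnorm b n * kummer b n y
   - (lagnorm b n * (b + n%:R)) * kummer b n.+1 y - (lagnorm b n * n%:R) * kummer b n.-1 y)).
  by ring.
(* For n > 0 the signs (-1)^(n+1) and (-1)^(n-1) are both opposite to (-1)^n, which makes the
   off-diagonal terms positive. At n = 0 the predecessor has the wrong sign, but its coefficient is
   0. *)
rewrite h1 h2; case: n h1 h2 => [|n] _ _.
  by rewrite mul0r sqrtr0 /=; ring.
by rewrite /= !exprS; ring.
Qed.

End laguerre_recurrence.

Section subexponential.
Variable R : realType.
Implicit Types f g : R -> R.

(** Growth below every exponential rate, rather than below one fixed rate, is stable under products;
    so the class contains the polynomials and, with f, also f^2. *)
Definition subexp f := measurable_fun setT f /\
  forall c : R, 0 < c -> exists C : R, forall x, `|f x| <= C * expR (c * `|x|).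

Lemma subexp_cst a : subexp (cst a).
Proof.
split=> // c c0; exists `|a| => x; rewrite ler_peMr//.
by rewrite -expR0 ler_expR mulr_ge0// ltW.
Qed.

Lemma subexp_id : subexp id.
Proof.
split=> // c c0; exists c^-1 => x; rewrite mulrC ler_pdivlMr// mulrC.
by apply: le_trans (expR_ge1Dx _); rewrite lerDr.
Qed.

Lemma subexpD f g : subexp f -> subexp g -> subexp (fun x => f x + g x).
Proof.
move=> [mf fc] [mg gc]; split; first exact: measurable_funD.
move=> c c0; have [C CP] := fc c c0; have [D DP] := gc c c0.
by exists (C + D) => x; rewrite mulrDl (le_trans (ler_normD _ _))// lerD.
Qed.

Lemma subexpM f g : subexp f -> subexp g -> subexp (fun x => f x * g x).
Proof.
move=> [mf fc] [mg gc]; split; first exact: measurable_funM.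
move=> c c0; have c2 : 0 < c / 2 by rewrite divr_gt0.
have [C CP] := fc _ c2; have [D DP] := gc _ c2.
exists (C * D) => x; rewrite normrM.
have -> : c * `|x| = c / 2 * `|x| + c / 2 * `|x| by field.
by rewrite expRD mulrACA ler_pM.
Qed.

Lemma subexpX f n : subexp f -> subexp (fun x => f x ^+ n).
Proof.
move=> fs; elim: n => [|n IH]; first exact: subexp_cst.
by under eq_fun do rewrite exprS; exact: subexpM.
Qed.

Lemma subexp_sum n (F : nat -> R -> R) : (forall i, subexp (F i)) ->
  subexp (fun x => \sum_(i < n) F i x).
Proof.
move=> Fs; elim: n => [|n IH].
  by under eq_fun do rewrite big_ord0; exact: subexp_cst.
by under eq_fun do rewrite big_ord_recr/=; exact: subexpD.
Qed.

Lemma subexp_laguerre n a r : 0 < a + 1 -> subexp (fun x => laguerre n a (x / r)).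
Proof.
move=> a0; under eq_fun do rewrite laguerreE//.
apply: subexpM; first exact: subexp_cst.
rewrite /kummer.
apply: (@subexp_sum n.+1
  (fun j x => (-1) ^+ j * 'C(n, j)%:R / pochhammer (a + 1) j * (x / r) ^+ j)) => j.
apply: subexpM; first exact: subexp_cst.
by apply: subexpX; apply: subexpM; [exact: subexp_id|exact: subexp_cst].
Qed.

End subexponential.

(** * Moments and integrability for the Gamma weight *)

#[local] Instance ae_Wmeasure_filter (R : realType) (k r : R) :
  Filter (almost_everywhere (Wmeasure k r)).
Proof.
exact: (ae_filter_ringOfSetsType
  (Wmeasure k r : {measure set (measurableTypeR R) -> \bar R})).
Qed.

Section gamma_measure.
Variables (R : realType) (k r : R).
Hypotheses (k0 : 0 < k) (r0 : 0 < r).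
Local Notation mu := (@lebesgue_measure R).
Local Notation nu := (Wmeasure k r : {measure set (measurableTypeR R) -> \bar R}).

Let k2 : 0 < 2 * k. Proof. by rewrite mulr_gt0. Qed.
Let c : R := r `^ (- (2 * k)) / Gamma (2 * k).
Let c0 : 0 < c. Proof. by rewrite divr_gt0 ?powR_gt0// Gamma_gt0. Qed.
Let rV0 : 0 < r^-1. Proof. by rewrite invr_gt0. Qed.

Lemma W_gterm x : W k r x = c * gterm (2 * k - 1) r^-1 x.
Proof. by rewrite /W /gterm /c mulNr [x / r]mulrC; ring. Qed.

Lemma ge0_integral_W (f : R -> R) : (forall x, 0 <= f x) -> measurable_fun setT f ->
  (\int[nu]_x (f x)%:E = c%:E * \int[mu]_(x in `]0%R, +oo[) (f x * gterm (2 * k - 1) r^-1 x)%:E)%E.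
Proof.
(* The measure is one on all of R, so its density is [W] cut off outside the half-line. *)
move=> f0 mf; pose w := W k r \_ `[0%R, +oo[.
have mw : measurable_fun setT w.
  have mW := measurable_W k r.
  by apply/(measurable_restrictT _ (measurable_itv _)); exact: measurable_funTS.
have w0 x : 0 <= w x by rewrite /w patchE; case: ifP => // _; exact: W_ge0.
rewrite (@ge0_integral_density _ _ _ mu nu w mw w0 _ f f0 mf); last first.
  by move=> A mA; rewrite [LHS]integral_mkcondr; apply: eq_integral => x _; rewrite restrict_EFin.
have mg D : measurable_fun D (fun x => (f x * gterm (2 * k - 1) r^-1 x)%:E).
  apply/measurable_EFinP; apply: measurable_funM; last exact: measurable_gterm.
  exact: measurable_funTS.
rewrite integral_itv_obnd_cbnd// -ge0_integralZl//; last 2 first.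
- by move=> x _; rewrite lee_fin mulr_ge0// gterm_ge0.
- by rewrite lee_fin ltW.
rewrite [RHS]integral_mkcond; apply: eq_integral => x _.
rewrite /w !patchE; case: ifP => _; last by rewrite mulr0.
by rewrite W_gterm -EFinM mulrCA.
exact: mg.
Qed.

Lemma ae_W_gt0 : {ae nu, forall x, 0 < x}.
Proof.
exists `]-oo, 0%R]%classic; split.
- exact: measurable_itv.
- rewrite /= /Wmeasure.
  rewrite (_ : _ `&` _ = [set 0]); first by rewrite integral_set1.
  apply/seteqP; split => x /=; rewrite !in_itv/= andbT.
    by move=> [a b]; apply/eqP; rewrite eq_le a b.
  by move=> ->.
- by move=> x /= /negP; rewrite -leNgt in_itv.
Qed.

Lemma gint_moment n : gint (2 * k - 1 + n%:R) r^-1 =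
  (r ^+ n * pochhammer (2 * k) n * (r `^ (2 * k) * Gamma (2 * k)))%:E.
Proof.
elim: n => [|n IH].
  rewrite addr0 expr0 pochhammer0 !mul1r gint_scale// -Gamma_gint// -EFinM.
  rewrite -[r^-1]powR_inv1 ?(ltW r0)// -powRrM mulN1r opprK//.
have kn : 0 < 2 * k + n%:R by rewrite ltr_wpDr.
have := gint_rec kn rV0.
have -> : 2 * k + n%:R - 1 = 2 * k - 1 + n%:R by ring.
have -> : 2 * k + n%:R = 2 * k - 1 + n.+1%:R by rewrite -natr1; ring.
rewrite IH -EFinM => E.
have -> : gint (2 * k - 1 + n.+1%:R) r^-1 = (r%:E * (r^-1%:E * gint (2 * k - 1 + n.+1%:R) r^-1))%E.
  by rewrite muleA -EFinM divff ?mul1e ?gt_eqF.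
rewrite -E -EFinM pochhammerS exprS -natr1; congr (_%:E); ring.
Qed.

(** With |x| the integrand is nonnegative on all of R, so [ge0_integral_W] applies; [moment] removes
    the absolute value almost everywhere. *)
Lemma moment_abs n : (\int[nu]_x (`|x| ^+ n)%:E = (r ^+ n * pochhammer (2 * k) n)%:E)%E.
Proof.
rewrite ge0_integral_W//; last by apply: measurable_funX; exact: normr_measurable.
rewrite (_ : (\int[mu]_(x in _) _)%E = gint (2 * k - 1 + n%:R) r^-1); last first.
  apply: eq_integral => x; rewrite inE/= in_itv/= andbT => x0.
  rewrite /gterm [x `^ (_ + n%:R)]powRD; last by rewrite (gt_eqF x0) implybT.
  rewrite (powR_mulrn n (ltW x0)) gtr0_norm//; congr (_%:E); ring.
rewrite gint_moment -EFinM /c powRN; congr (_%:E); field.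
by rewrite !gt_eqF ?Gamma_gt0// powR_gt0.
Qed.

(** Half of the decay rate 1/r of the weight is spent, and the remaining half leaves a finite Gamma
    integral. *)
Lemma integral_expR_W : (\int[nu]_x (expR (r^-1 / 2 * `|x|))%:E < +oo)%E.
Proof.
rewrite ge0_integral_W; [|by move=> x; exact: expR_ge0|]; last first.
  by apply: measurableT_comp => //; apply: measurable_funM => //; exact: normr_measurable.
rewrite (_ : (\int[mu]_(x in _) _)%E = gint (2 * k - 1) (r^-1 / 2)); last first.
  apply: eq_integral => x; rewrite inE/= in_itv/= andbT => x0.
  rewrite /gterm gtr0_norm// mulrCA -expRD; congr ((_ * expR _)%:E); field.
  by rewrite gt_eqF.
by rewrite lte_mul_pinfty ?lee_fin ?(ltW c0)// gint_fin// divr_gt0.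
Qed.

Lemma integrable_W (f : R -> R) C : measurable_fun setT f ->
  (forall x, `|f x| <= C * expR (r^-1 / 2 * `|x|)) -> nu.-integrable setT (EFin \o f).
Proof.
move=> mf fC.
have m1 : measurable_fun setT (fun x : R => expR (r^-1 / 2 * `|x|)).
  by apply: measurableT_comp => //; apply: measurable_funM => //; exact: normr_measurable.
have C0 : 0 <= C by have := fC 0; rewrite normr0 mulr0 expR0 mulr1; apply: le_trans.
apply/integrableP; split; first exact/measurable_EFinP.
apply: (@le_lt_trans _ _ (\int[nu]_x (C%:E * (expR (r^-1 / 2 * `|x|))%:E))%E).
  apply: ge0_le_integral => //=.
  - by apply/measurable_EFinP; exact: measurableT_comp.
  - by apply/measurable_EFinP; exact: measurable_funM.
  - by move=> x _; rewrite -EFinM lee_fin.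
rewrite ge0_integralZl//; last exact/measurable_EFinP.
by rewrite lte_mul_pinfty ?lee_fin// integral_expR_W.
Qed.

Lemma subexp_integrable (f : R -> R) : subexp f -> nu.-integrable setT (EFin \o f).
Proof.
move=> [mf fc]; have [|C CP] := fc (r^-1 / 2); first by rewrite divr_gt0.
exact: integrable_W CP.
Qed.

Lemma subexp_Lfun2 (f : R -> R) : subexp f -> f \in Lfun nu 2%:E.
Proof.
move=> fs; apply/Lfun2P; split; first by case: fs.
by apply: subexp_integrable; exact: subexpX.
Qed.

Lemma moment n : \int[nu]_x (x ^+ n) = r ^+ n * pochhammer (2 * k) n.
Proof.
apply/EFin_inj; rewrite -moment_abs /Rintegral fineK; last first.
  by apply: integrable_fin_num => //; apply: (subexp_integrable (subexpX n (@subexp_id R))).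
apply: ae_eq_integral => //.
- by apply/measurable_EFinP; exact: measurable_funX.
- by apply/measurable_EFinP; apply: measurable_funX; exact: normr_measurable.
- by apply: filterS ae_W_gt0 => x x0 _; rewrite gtr0_norm.
Qed.

End gamma_measure.

(** * Determinacy of the moment problem *)

Section exponential_series.
Variable R : realType.

Lemma series_exp_le (y : R) n : 0 <= y -> series (exp_coeff y) n <= expR y.
Proof.
move=> y0; apply: nondecreasing_cvgn_le; last exact: is_cvg_series_exp_coeff.
by apply: nondecreasing_series => i _ _; exact: exp_coeff_ge0.
Qed.

Lemma norm_series_exp_le (y : R) n : `|series (exp_coeff y) n| <= expR `|y|.
Proof.
apply: le_trans (series_exp_le n (normr_ge0 y)).
rewrite !seriesEnat/=; apply: le_trans (ler_norm_sum _ _ _) _.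
by apply: ler_sum => i _; rewrite /exp_coeff/= normrM normrX normfV (ger0_norm (ler0n _ _)) lexx.
Qed.

Context d (T : measurableType d) (mu : {measure set T -> \bar R}).

(* Expand the exponential and integrate term by term. *)
Lemma integral_expR_eq0 (u v : T -> R) :
  measurable_fun setT u -> measurable_fun setT v ->
  mu.-integrable setT (EFin \o (fun x => expR `|u x| * v x)) ->
  (forall j, \int[mu]_x (u x ^+ j * v x) = 0) ->
  \int[mu]_x (expR (u x) * v x) = 0.
Proof.
move=> mu_ mv iuv uv0.
have mE (w : T -> R) : measurable_fun setT w -> measurable_fun setT (fun x => expR (w x)).
  by move=> mw; exact: measurableT_comp.
(* The powers of u and the partial sums of its exponential series all satisfy this bound, so one
   integrability hypothesis covers every integral below. *)
have dom (f : T -> R) C : measurable_fun setT f -> (forall x, `|f x| <= C * expR `|u x|) ->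
    mu.-integrable setT (EFin \o (fun x => f x * v x)).
  move=> mf fu; have := @integrableZl _ _ _ mu _ measurableT C _ iuv.
  apply: le_integrable => //.
    by apply/measurable_EFinP; exact: measurable_funM.
  move=> x _ /=; rewrite lee_fin !normrM mulrA ler_wpM2r//.
  apply: le_trans (fu x) _; rewrite [`|expR _|]ger0_norm ?expR_ge0//.
  by rewrite ler_wpM2r ?expR_ge0// ler_norm.
pose f_ n x := series (exp_coeff (u x)) n * v x.
have ms n : measurable_fun setT (fun x => series (exp_coeff (u x)) n).
  rewrite /series/=; apply: measurable_sum => i.
  by rewrite /exp_coeff/=; apply: measurable_funM => //; exact: measurable_funX.
have int0 n : \int[mu]_x f_ n x = 0.
  elim: n => [|n IH].
    rewrite /f_; under eq_Rintegral do rewrite seriesEnat/= big_geq// mul0r.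
    by rewrite /Rintegral integral0.
  rewrite /f_; under eq_Rintegral do rewrite seriesSr mulrDl.
  rewrite RintegralD//.
  - rewrite [X in X + _]IH add0r /exp_coeff/=.
    under eq_Rintegral do rewrite mulrAC mulrC.
    rewrite RintegralZl ?uv0 ?mulr0//.
    apply: (dom (fun x => u x ^+ n) n`!%:R); first exact: measurable_funX.
    move=> x; have := exprn_le_expR n (@ltr01 R) (normr_ge0 (u x)).
    by rewrite normrX expr1n divr1 mul1r.
  - by apply: (dom _ 1) => // x; rewrite mul1r; exact: norm_series_exp_le.
  - apply: (dom _ 1); first by rewrite /exp_coeff/=; apply: measurable_funM => //;
      exact: measurable_funX.
    move=> x; have := exprn_le_expR n (@ltr01 R) (normr_ge0 (u x)).
    rewrite expr1n divr1 !mul1r /exp_coeff/= normrM normrX normfV (ger0_norm (ler0n _ _)).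
    by rewrite ler_pdivrMr ?ltr0n ?fact_gt0// mulrC.
have [|||||_ _] := @dominated_convergence _ _ _ mu setT measurableT (fun n => EFin \o f_ n)
  (EFin \o (fun x => expR (u x) * v x)) (fun x => `|(expR `|u x| * v x)%:E|)%E.
- by move=> n; apply/measurable_EFinP; exact: measurable_funM.
- by apply/measurable_EFinP; apply: measurable_funM => //; exact: mE.
- apply: nearW => x _; apply: cvg_EFin; first exact: nearW.
  by apply: cvgMl; exact: is_cvg_series_exp_coeff.
- exact: integrable_abse.
- apply: nearW => x n _ /=; rewrite lee_fin !normrM ler_wpM2r//.
  by apply: le_trans (norm_series_exp_le _ _) _; rewrite ler_norm.
move=> /= c1; rewrite /Rintegral -(cvg_lim _ c1)//.
rewrite (_ : (fun n => _) = cst 0%E); first by rewrite lim_cst.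
apply/funext => n /=.
have := int0 n; rewrite /Rintegral => h; rewrite -[LHS]fineK ?h//.
apply: integrable_fin_num => //; apply: (dom _ 1) => // x; rewrite mul1r; exact: norm_series_exp_le.
Qed.

End exponential_series.

Section half_lines.
Variable R : realType.
Variable nu : {measure set (measurableTypeR R) -> \bar R}.

(** Half-lines form a family stable under intersection that generates the Borel sets, and the sets
    over which g integrates to 0 form a Dynkin system; so the integral vanishes over every Borel
    set. *)
Lemma ae_eq0_half_lines (g : R -> R) : nu.-integrable setT (EFin \o g) ->
  (\int[nu]_x (g x)%:E = 0)%E ->
  (forall a, \int[nu]_(x in `]a, +oo[) (g x)%:E = 0)%E ->
  {ae nu, forall x, g x = 0}.
Proof.
move=> ig gT ga.
have iS S : measurable S -> nu.-integrable S (EFin \o g).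
  by move=> mS; apply: integrableS ig.
have H S : measurable S -> (\int[nu]_(x in S) (g x)%:E = 0)%E.
  move=> mS; have : <<s @RGenOInfty.G R >> S.
    by move: mS; rewrite -[measurable S]/((@ocitv R).-sigma.-measurable S) RGenOInfty.measurableE.
  apply: (dynkin_induction (T := measurableTypeR R)
    (P := fun S => (\int[nu]_(x in S) (g x)%:E = 0)%E)).
  - exact: RGenOInfty.measurableE.
  - move=> _ _ [a ->] [b ->]; exists (Num.max a b).
    by apply/seteqP; split => x /=; rewrite !in_itv/= !andbT gt_max => /andP.
  - exact: gT.
  - by move=> _ [a ->]; exact: ga.
  - move=> A mA A0; have := gT; rewrite -(setUv A) integral_setU//.
    + by rewrite A0 add0e.
    + exact: measurableC.
    + exact: measurable_int (iS _ (measurableU _ _ mA (measurableC mA))).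
    + by apply/disj_setPCl.
  - move=> F mF tF F0; rewrite integral_bigcup//; last by apply: iS; exact: bigcup_measurable.
    by rewrite eseries0.
have : ae_eq nu setT (EFin \o g) (cst 0%E).
  apply: integral_ae_eq => // E _ mE; rewrite [RHS]integral0; exact: H.
by apply: filterS => x /(_ I) [].
Qed.

End half_lines.

(** * A square-integrable function with vanishing moments is null *)

Section moment_problem.
Variables (R : realType) (k r : R).
Hypotheses (k0 : 0 < k) (r0 : 0 < r).
Local Notation nu := (Wmeasure k r : {measure set (measurableTypeR R) -> \bar R}).

Let rV0 : 0 < r^-1. Proof. by rewrite invr_gt0. Qed.

Lemma Lfun2_W (f : R -> R) C : measurable_fun setT f ->
  (forall x, `|f x| <= C * expR (r^-1 / 4 * `|x|)) -> f \in Lfun nu 2%:E.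
Proof.
move=> mf fC; apply/Lfun2P; split => //.
apply: (integrable_W k0 r0 (C := C ^+ 2)); first exact: measurable_funX.
move=> x; have -> : r^-1 / 2 * `|x| = r^-1 / 4 * `|x| + r^-1 / 4 * `|x|.
  by field; rewrite gt_eqF.
by rewrite expRD -expr2 -exprMn normrX lerXn2r ?nnegrE// (le_trans _ (fC x)).
Qed.

Variable g : R -> R.
Hypothesis g2 : g \in Lfun nu 2%:E.

Let mg : measurable_fun setT g. Proof. by have /Lfun2P[] := g2. Qed.

Lemma integrable_mul_W (f : R -> R) C : measurable_fun setT f ->
  (forall x, `|f x| <= C * expR (r^-1 / 4 * `|x|)) ->
  nu.-integrable setT (EFin \o (fun x => f x * g x)).
Proof.
by move=> mf fC; apply/Lfun1_integrable; apply: Lfun2_mul_Lfun1 => //; exact: Lfun2_W fC.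
Qed.

(** Half of the admissible rate 1/(4r): in [laplace_step] one copy of c pays for the exponential
    being expanded, the other for the power of |x|. *)
Let c := r^-1 / 8.
Let c0 : 0 < c. Proof. by rewrite divr_gt0. Qed.
Let cc : r^-1 / 4 = c + c. Proof. by rewrite /c; field; rewrite gt_eqF. Qed.

Let mexp (a : R) : measurable_fun setT (fun x : R => expR (a * `|x|)).
Proof. by apply: measurableT_comp => //; exact: measurable_funM. Qed.

Let mpe n (a : R) : measurable_fun setT (fun x : R => `|x| ^+ n * expR (a * `|x|)).
Proof. by apply: measurable_funM; [exact: measurable_funX|exact: mexp]. Qed.

(** Expand exp(-c |x|) and keep the rest as a factor. The expansion produces |x|^(n+j), which is why
    the statement is about all powers at once. *)
Lemma laplace_step (z : R) : 0 <= z ->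
  (forall n, \int[nu]_x (`|x| ^+ n * expR (- z * `|x|) * g x) = 0) ->
  forall n, \int[nu]_x (`|x| ^+ n * expR (- (z + c) * `|x|) * g x) = 0.
Proof.
move=> z0 H n.
have E (x : R) : `|x| ^+ n * expR (- (z + c) * `|x|) * g x =
    expR (- c * `|x|) * (`|x| ^+ n * expR (- z * `|x|) * g x).
  by rewrite opprD mulrDl expRD; ring.
under eq_Rintegral do rewrite E.
apply: integral_expR_eq0.
- exact: measurable_funM.
- by apply: measurable_funM => //; exact: mpe.
- have := @integrable_mul_W (fun x => expR (`|- c * `|x| |) * (`|x| ^+ n * expR (- z * `|x|)))
  (n`!%:R / c ^+ n).
  rewrite (_ : EFin \o _ = EFin \o (fun x => expR `|- c * `|x| | *
    (`|x| ^+ n * expR (- z * `|x|) * g x))); last first.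
    by apply/funext => x /=; rewrite [in RHS]mulrA.
  apply.
    apply: measurable_funM; last exact: mpe.
    by apply: measurableT_comp => //; apply: measurableT_comp => //; exact: measurable_funM.
  move=> x; rewrite cc mulrDl expRD mulrA normrM mulNr normrN
    (ger0_norm (mulr_ge0 (ltW c0) (normr_ge0 x))).
  rewrite ger0_norm ?expR_ge0// mulrC ler_wpM2r ?expR_ge0//.
  rewrite ger0_norm ?mulr_ge0 ?exprn_ge0 ?expR_ge0//.
  apply: (@le_trans _ _ (`|x| ^+ n)); last exact: exprn_le_expR.
  by rewrite ler_piMr ?exprn_ge0// expR_le1 mulNr oppr_le0 mulr_ge0.
- move=> j; under eq_Rintegral => x _.
    rewrite (_ : _ ^+ j * _ = (- c) ^+ j * (`|x| ^+ (n + j) * expR (- z * `|x|) * g x)); last first.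
      by rewrite exprMn exprD; ring.
    over.
  rewrite RintegralZl ?H ?mulr0//.
  apply: (@integrable_mul_W _ ((n + j)`!%:R / c ^+ (n + j) * expR 0)).
    exact: mpe.
  move=> x; rewrite ger0_norm ?mulr_ge0 ?exprn_ge0 ?expR_ge0// expR0 mulr1.
  apply: (@le_trans _ _ (`|x| ^+ (n + j))).
    by rewrite ler_piMr ?exprn_ge0// expR_le1 mulNr oppr_le0 mulr_ge0.
  apply: le_trans (exprn_le_expR (n + j) c0 (normr_ge0 x)) _.
  rewrite ler_wpM2l ?divr_ge0 ?exprn_ge0 ?(ltW c0)// ler_expR cc mulrDl lerDl mulr_ge0// ltW//.
Qed.

Hypothesis mom0 : forall n, \int[nu]_x (x ^+ n * g x) = 0.

Lemma laplace_eq0 j n : \int[nu]_x (`|x| ^+ n * expR (- (j%:R * c) * `|x|) * g x) = 0.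
Proof.
elim: j n => [|j IH] n.
  rewrite -[RHS](mom0 n) /Rintegral; congr fine; apply: ae_eq_integral => //.
  - by apply/measurable_EFinP; apply: measurable_funM => //; exact: mpe.
  - by apply/measurable_EFinP; apply: measurable_funM => //; exact: measurable_funX.
  - apply: filterS (ae_W_gt0 k r) => x x0 _.
    by rewrite mul0r oppr0 mul0r expR0 mulr1 gtr0_norm.
rewrite -natr1 mulrDl mul1r; apply: laplace_step => //.
by rewrite mulr_ge0// ltW.
Qed.

Let ig : nu.-integrable setT (EFin \o g).
Proof.
have := @integrable_mul_W (cst 1) 1; under eq_fun do rewrite /= mul1r; apply => // x.
by rewrite normr1 mul1r -expR0 ler_expR mulr_ge0// divr_ge0// ltW.
Qed.

(** The inner exponential is K exp(-m c |x|) with K constant, so the j-th term of the outer series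
    is a Laplace transform at j m c, covered by [laplace_eq0]. Being at most K, it also keeps the
    dominating function bounded. *)
Lemma integral_expR_expR (a : R) m :
  \int[nu]_x (expR (- expR (m%:R * (c * (a - `|x|)))) * g x) = 0.
Proof.
set K := expR (m%:R * (c * a)).
have E (x : R) : - expR (m%:R * (c * (a - `|x|))) = - K * expR (- (m%:R * c) * `|x|).
  by rewrite mulNr -expRD; congr (- expR _); ring.
under eq_Rintegral do rewrite E.
have mu_ : measurable_fun setT (fun x : R => - K * expR (- (m%:R * c) * `|x|)).
  exact: measurable_funM.
apply: integral_expR_eq0 => //.
- apply: (@integrable_mul_W _ (expR K)).
    by apply: measurableT_comp => //; exact: measurableT_comp.
  move=> x; rewrite ger0_norm ?expR_ge0// -[leLHS]mulr1 ler_pM ?expR_ge0//.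
    rewrite ler_expR normrM normrN ger0_norm ?expR_ge0// ger0_norm ?expR_ge0//.
    by rewrite ler_piMr ?expR_ge0// expR_le1 mulNr oppr_le0 !mulr_ge0// ltW.
  by rewrite -expR0 ler_expR mulr_ge0// divr_ge0// ltW.
- move=> j; under eq_Rintegral => x _.
    rewrite (_ : _ ^+ j * _ = (- K) ^+ j *
      (`|x| ^+ 0 * expR (- ((j * m)%:R * c) * `|x|) * g x)); last first.
      rewrite exprMn expr0 mul1r -expRM_natl -mulrA; congr (_ * (expR _ * _)).
      by rewrite natrM; ring.
    over.
  rewrite RintegralZl ?laplace_eq0 ?mulr0//.
  apply: (@integrable_mul_W _ 1); first exact: mpe.
  move=> x; rewrite expr0 mul1r mul1r ger0_norm ?expR_ge0// ler_expR.
  apply: (@le_trans _ _ 0); first by rewrite mulNr oppr_le0 !mulr_ge0// ltW.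
  by rewrite mulr_ge0// divr_ge0// ltW.
Qed.

(* [exp (- exp (m y))] tends to the indicator of [y < 0] away from [y = 0]. *)
Lemma cvg_expR_expR (y : R) : y != 0 ->
  (fun m => expR (- expR (m%:R * y))) @ \oo --> ((y < 0)%R%:R : R).
Proof.
case: (ltgtP y 0) => // yy _ /=.
  rewrite mulr1n -[X in _ --> X]expR0 -oppr0.
  apply: (@cvg_comp _ _ _ (fun m => - expR (m%:R * y)) expR _ (nbhs (- 0)));
    last exact: continuous_expR.
  apply: cvgN; under eq_fun do rewrite expRM_natl.
  by apply: cvg_expr; rewrite ger0_norm ?expR_ge0// expR_lt1.
rewrite mulr0n.
apply: (@squeeze_cvgr _ _ _ _ (cst 0) (fun m => expR (- y) ^+ m)).
- apply: nearW => m /=; rewrite expR_ge0/= -expRM_natl ler_expR mulrN lerN2.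
  by apply: le_trans (expR_ge1Dx _); rewrite lerDr.
- exact: cvg_cst.
- by apply: cvg_expr; rewrite ger0_norm ?expR_ge0// expR_lt1 oppr_lt0.
Qed.

Lemma moments_eq0 : {ae nu, forall x, g x = 0}.
Proof.
apply: ae_eq0_half_lines => //.
  have := mom0 0; rewrite /Rintegral; under eq_integral do rewrite expr0 mul1r.
  by move=> h; rewrite -[LHS]fineK ?h//; exact: integrable_fin_num.
move=> a.
(* At x = a the sequence stays at exp(-1) instead of tending to a value of the indicator; this one
   point is null. *)
have nu1 : {ae nu, forall x, x != a}.
  exists [set a]; split => //.
    by rewrite /Wmeasure/=; apply: integral_Sset1; exact: subIsetl.
  by move=> x /= /negP; rewrite negbK => /eqP.
have [|||||_ _] := @dominated_convergence _ _ _ nu setT measurableT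
  (fun m x => (expR (- expR (m%:R * (c * (a - `|x|)))) * g x)%:E)
  (fun x => (\1_(`]a, +oo[%classic) x * g x)%:E) (abse \o (EFin \o g)).
- move=> m; apply/measurable_EFinP; apply: measurable_funM => //.
  apply: measurableT_comp => //; apply: measurableT_comp => //; apply: measurableT_comp => //.
  by apply: measurable_funM => //; apply: measurable_funM => //; exact: measurable_funB.
- by apply/measurable_EFinP; apply: measurable_funM.
- apply: filterS2 nu1 (ae_W_gt0 k r) => x xa x0 _; apply: cvg_EFin; first exact: nearW.
  apply: cvgMl; rewrite gtr0_norm//.
  have -> : \1_(`]a, +oo[%classic) x = (c * (a - x) < 0)%R%:R :> R.
    by rewrite indicE mem_setE in_itv/= andbT pmulr_rlt0// subr_lt0.
  by apply: cvg_expR_expR; apply: mulf_neq0; [rewrite gt_eqF|rewrite subr_eq0 eq_sym].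
- exact: integrable_abse.
- apply: nearW => x m _ /=; rewrite lee_fin normrM ler_piMl//.
  by rewrite ger0_norm ?expR_ge0// expR_le1 oppr_le0 expR_ge0.
move=> c1.
rewrite integral_mkcond.
transitivity (\int[nu]_x (\1_(`]a, +oo[%classic) x * g x)%:E)%E.
  apply: eq_integral => x _; rewrite patchE indicE.
  by case: ifP => _; rewrite ?mul1r ?mul0r.
rewrite -(cvg_lim _ c1)// (_ : (fun n => _) = cst 0%E); first by rewrite lim_cst.
apply/funext => m /=; have := integral_expR_expR a m; rewrite /Rintegral => h.
rewrite -[LHS]fineK ?h//; apply: integrable_fin_num => //.
apply: (@integrable_mul_W _ 1).
  apply: measurableT_comp => //; apply: measurableT_comp => //; apply: measurableT_comp => //.
  by apply: measurable_funM => //; apply: measurable_funM => //; exact: measurable_funB.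
move=> x; rewrite mul1r ger0_norm ?expR_ge0// ler_expR (@le_trans _ _ 0)//.
by rewrite mulr_ge0// divr_ge0// ltW.
Qed.

End moment_problem.

(** * Completeness and orthonormality of the Laguerre system *)

(* A symmetric tridiagonal multiplication operator has orthonormal eigenvectors once
   the first row of the Gram matrix is right. *)
Lemma gram_tridiagonal (R : realType) (c e : nat -> R) (G : nat -> nat -> R) :
  (forall n, c n != 0) ->
  (forall m n, c m * G m.+1 n + e m * G m n + (if m is m'.+1 then c m' * G m' n else 0) =
               c n * G m n.+1 + e n * G m n + (if n is n'.+1 then c n' * G m n' else 0)) ->
  (forall n, G 0%N n = (n == 0%N)%:R) ->
  forall m n, G m n = (m == n)%:R.
Proof.
move=> c0 rec G0.
have A m n : c m * (m.+1 == n)%:R = if n is n'.+1 then c n' * (m == n')%:R else 0.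
  by case: n => [|n]; rewrite ?mulr0// eqSS; case: eqP => [->|]; rewrite ?mulr0.
(* The recurrence gives row m + 1 from rows m and m - 1, so the induction carries two consecutive
   rows. *)
suff H m : (forall n, G m n = (m == n)%:R) /\
    (if m is m'.+1 then forall n, G m' n = (m' == n)%:R else True).
  by move=> m n; exact: (H m).1.
elim: m => [|m [IH IH1]]; first by split=> // n; rewrite G0 eq_sym.
split=> // n; apply: (mulfI (c0 m)); rewrite A; have := rec m n; rewrite !IH.
have -> : (if m is m'.+1 then c m' * G m' n else 0) = c n * (m == n.+1)%:R.
  by rewrite eq_sym A; case: m {IH rec} IH1 => // m' ->; rewrite eq_sym.
have -> : e m * (m == n)%:R = e n * (m == n)%:R by case: eqP => [->|]; rewrite ?mulr0.
have -> : (if n is n'.+1 then c n' * G m n' else 0) = if n is n'.+1 then c n' * (m == n')%:R else 0.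
  by case: n => // n; rewrite IH.
by rewrite -addrA [RHS]addrC [c n * _ + _]addrC => /addIr.
Qed.

Section laguerre_basis.
Variables (R : realType) (k r : R).
Hypotheses (k0 : 0 < k) (r0 : 0 < r).
Local Notation nu := (Wmeasure k r : {measure set (measurableTypeR R) -> \bar R}).

Let k2 : 0 < 2 * k. Proof. by rewrite mulr_gt0. Qed.
Let a1 : 2 * k - 1 + 1 = 2 * k. Proof. by rewrite subrK. Qed.
Let a0 : 0 < 2 * k - 1 + 1. Proof. by rewrite a1. Qed.

Definition lag n x := laguerre n (2 * k - 1) (x / r).

Definition up_coef n : R := Num.sqrt (n.+1%:R * (2 * k + n%:R)).
Definition down_coef n : R := Num.sqrt (n%:R * (2 * k + n%:R - 1)).

Lemma down_coef0 : down_coef 0 = 0.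
Proof. by rewrite /down_coef mul0r sqrtr0. Qed.

Lemma down_coefS n : down_coef n.+1 = up_coef n.
Proof. by rewrite /down_coef /up_coef -natr1; congr Num.sqrt; ring. Qed.

Lemma up_coef_gt0 n : 0 < up_coef n.
Proof. by rewrite sqrtr_gt0 mulr_gt0// ltr_wpDr. Qed.

Lemma lag_rec n x : x * lag n x =
  r * (up_coef n * lag n.+1 x + 2 * (k + n%:R) * lag n x + down_coef n * lag n.-1 x).
Proof.
have := laguerre_rec n (x / r) a0; rewrite a1 -/(lag _ _) => E.
have -> : x * lag n x = r * (x / r * lag n x) by field; rewrite gt_eqF.
by rewrite E /up_coef /down_coef /lag; ring.
Qed.

Lemma subexp_lag n : subexp (lag n).
Proof. exact: subexp_laguerre. Qed.

Lemma lag0 x : lag 0 x = 1.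
Proof. exact: laguerre0. Qed.

Let G m n := \int[nu]_x (lag m x * lag n x).

Let iLL m n : nu.-integrable setT (EFin \o (fun x => lag m x * lag n x)).
Proof. by apply: subexp_integrable => //; apply: subexpM; exact: subexp_lag. Qed.

Let iZ (z : R) (f : R -> R) : nu.-integrable setT (EFin \o f) ->
  nu.-integrable setT (EFin \o (fun x => z * f x)).
Proof. by move=> fi; exact: (@integrableZl _ _ _ nu _ measurableT z _ fi). Qed.

(** The moment r^j (2k)_j cancels the denominators of the j-th coefficient; what remains is the
    binomial expansion of (1 - 1)^n. *)
Lemma integral_lag n : \int[nu]_x lag n x = (n == 0%N)%:R.
Proof.
have E N (c : nat -> R) : nu.-integrable setT (EFin \o (fun x => \sum_(j < N) c j * x ^+ j)) /\
    \int[nu]_x (\sum_(j < N) c j * x ^+ j) = \sum_(j < N) c j * (r ^+ j * pochhammer (2 * k) j).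
  elim: N => [|N [IH1 IH2]].
    split.
      under eq_fun do rewrite big_ord0.
      by apply: subexp_integrable => //; exact: subexp_cst.
    under eq_Rintegral do rewrite big_ord0.
    by rewrite big_ord0 /Rintegral integral0.
  have iX : nu.-integrable setT (EFin \o (fun x => x ^+ N)).
    by apply: subexp_integrable => //; apply: subexpX; exact: subexp_id.
  split.
    under eq_fun do rewrite big_ord_recr/=.
    by have := integrableD measurableT IH1 (iZ (c N) iX).
  under eq_Rintegral do rewrite big_ord_recr/=.
  rewrite RintegralD//; last exact: iZ.
  by rewrite IH2 RintegralZl// moment// big_ord_recr.
have -> : \int[nu]_x lag n x = \int[nu]_x (\sum_(j < n.+1)
    ((-1) ^+ n * lagnorm (2 * k) n *
      ((-1) ^+ j * 'C(n, j)%:R / pochhammer (2 * k) j / r ^+ j)) * x ^+ j).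
  apply: eq_Rintegral => x _; rewrite /lag laguerreE// a1 /kummer mulr_sumr.
  by apply: eq_bigr => j _; rewrite exprMn exprVn; ring.
have [_ ->] := E n.+1 (fun j => (-1) ^+ n * lagnorm (2 * k) n *
  ((-1) ^+ j * 'C(n, j)%:R / pochhammer (2 * k) j / r ^+ j)).
rewrite (eq_bigr (fun j : 'I_n.+1 => (-1) ^+ n * lagnorm (2 * k) n *
  ((1 ^+ (n - j) * (-1) ^+ j) *+ 'C(n, j)))); last first.
  move=> j _; rewrite expr1n mul1r -mulr_natr; field.
  by rewrite mul1r expf_neq0 ?gt_eqF// pochhammer_gt0.
rewrite -mulr_sumr -exprDn subrr expr0n; case: n => [|n]; last by rewrite mulr0.
by rewrite /lagnorm pochhammer0 fact0 divr1 sqrtr1 !mulr1.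
Qed.

Lemma lag_orthonormal m n : \int[nu]_x (lag m x * lag n x) = (m == n)%:R.
Proof.
have I3 m' n' : \int[nu]_x (up_coef m' * (lag m'.+1 x * lag n' x)
      + 2 * (k + m'%:R) * (lag m' x * lag n' x)
     + down_coef m' * (lag m'.-1 x * lag n' x)) =
   up_coef m' * G m'.+1 n' + 2 * (k + m'%:R) * G m' n' + down_coef m' * G m'.-1 n'.
  rewrite RintegralD//; last 2 first.
  - by have := integrableD measurableT (iZ (up_coef m') (iLL m'.+1 n'))
      (iZ (2 * (k + m'%:R)) (iLL m' n')).
  - exact: iZ.
  by rewrite RintegralD//; [rewrite !RintegralZl|exact: iZ|exact: iZ].
apply: (@gram_tridiagonal _ up_coef (fun n => 2 * (k + n%:R)) G) => [i|i j|i].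
- by rewrite gt_eqF// up_coef_gt0.
- have F p : (if p is p'.+1 then up_coef p' * G p' j else 0) = down_coef p * G p.-1 j.
    by case: p => [|p]; rewrite ?down_coef0 ?mul0r// down_coefS.
  have F' p : (if p is p'.+1 then up_coef p' * G i p' else 0) = down_coef p * G i p.-1.
    by case: p => [|p]; rewrite ?down_coef0 ?mul0r// down_coefS.
  rewrite F F'.
  have Gs p q : G p q = G q p by apply: eq_Rintegral => x _; rewrite mulrC.
  (* Both sides become integrals equal to 1/r times that of x [lag i x] [lag j x], once with the
     recurrence for i and once for j. *)
  rewrite -I3 (Gs i j.+1) (Gs i j.-1) (Gs i j) -I3.
  apply: eq_Rintegral => x _.
  have := lag_rec i x; have := lag_rec j x => E1 E2.
  apply: (mulfI (lt0r_neq0 r0)).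
  transitivity (x * lag i x * lag j x); first by rewrite E2; ring.
  by rewrite mulrAC E1; ring.
- rewrite /G; under eq_Rintegral do rewrite lag0 mul1r.
  exact: integral_lag.
Qed.

(** By induction on i the recurrence makes g orthogonal to every x^i [lag n]; as [lag 0] is 1, the
    case n = 0 yields the moments, with no inversion from Laguerre polynomials to monomials. *)
Lemma lag_complete (g : R -> R) : g \in Lfun nu 2%:E ->
  (forall n, \int[nu]_x (g x * lag n x) = 0) -> {ae nu, forall x, g x = 0}.
Proof.
move=> g2 gl.
have ilg (f : R -> R) : subexp f -> nu.-integrable setT (EFin \o (fun x => f x * g x)).
  move=> fs; apply/Lfun1_integrable; apply: Lfun2_mul_Lfun1 => //.
  exact: subexp_Lfun2.
have sxl i n : subexp (fun x => x ^+ i * lag n x).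
  by apply: subexpM; [apply: subexpX; exact: subexp_id|exact: subexp_lag].
have H i n : \int[nu]_x ((x ^+ i * lag n x) * g x) = 0.
  elim: i n => [|i IH] n.
    by rewrite -[RHS](gl n); apply: eq_Rintegral => x _; rewrite expr0 mul1r mulrC.
  under eq_Rintegral => x _.
    rewrite (_ : _ * g x = r * up_coef n * (x ^+ i * lag n.+1 x * g x) +
      r * (2 * (k + n%:R)) * (x ^+ i * lag n x * g x) +
      r * down_coef n * (x ^+ i * lag n.-1 x * g x)); last first.
      by rewrite exprSr -(mulrA (x ^+ i) x) lag_rec; ring.
    over.
  have i1 := iZ (r * up_coef n) (ilg _ (sxl i n.+1)).
  have i2 := iZ (r * (2 * (k + n%:R))) (ilg _ (sxl i n)).
  have i3 := iZ (r * down_coef n) (ilg _ (sxl i n.-1)).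
  rewrite RintegralD//; last by have := integrableD measurableT i1 i2.
  rewrite RintegralD// !RintegralZl ?IH ?mulr0 ?addr0//; exact: ilg.
apply: (moments_eq0 k0 r0 g2) => n.
by rewrite -[RHS](H n 0%N); apply: eq_Rintegral => x _; rewrite lag0 mulr1.
Qed.

Definition lag_vec n : L2W k r := L2_class nu (fun x => (lag n x)%:C).

Lemma sqint_lag n : (fun x => (lag n x)%:C) \in sqint nu.
Proof.
apply/andP; split; apply: subexp_Lfun2 => //; first exact: subexp_lag.
exact: subexp_cst.
Qed.

Lemma lag_vecE n : {ae nu, forall x, (lag_vec n : L2 nu) x = (lag n x)%:C}.
Proof. by apply: L2_classE; exact: sqint_lag. Qed.

Lemma lag_vec_on m n : L2_dot (lag_vec m) (lag_vec n) = (m == n)%:R.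
Proof.
rewrite (L2_dotE (sqint_lag m) (sqint_lag n) (lag_vecE m) (lag_vecE n)).
apply: complexP.
  rewrite /= -[RHS]/(Re ((m == n)%:R : R[i])).
  have -> : Re ((m == n)%:R : R[i]) = (m == n)%:R by case: (m == n).
  by rewrite -lag_orthonormal; apply: eq_Rintegral => x _; rewrite mul0r subr0.
rewrite /=; have -> : Im ((m == n)%:R : R[i]) = 0 by case: (m == n).
under eq_Rintegral do rewrite oppr0 mulr0 mul0r addr0.
by rewrite /Rintegral integral0.
Qed.

Lemma lag_vec_complete (g : L2 nu) : (forall n, L2_dot g (lag_vec n) = 0) -> g = 0.
Proof.
move=> g0; have /andP[gr gi] := L2_sqint g.
have D n : L2_dot g (lag_vec n) = (\int[nu]_x (Re (g x) * lag n x)) +i*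
    (\int[nu]_x (Im (g x) * lag n x)).
  rewrite (L2_dotE (L2_sqint g) (sqint_lag n) (nearW _ _) (lag_vecE n))//.
  apply: complexP => /=; apply: eq_Rintegral => x _.
    by rewrite cReM cReJ cImJ/= oppr0 mulr0 subr0.
  by rewrite cImM cReJ cImJ/= oppr0 mulr0 add0r.
have R0 := lag_complete gr (fun n => congr1 Re (etrans (esym (D n)) (g0 n))).
have I0 := lag_complete gi (fun n => congr1 Im (etrans (esym (D n)) (g0 n))).
apply: nrm2_eq0; apply/EFin_inj; rewrite nrm2_csq.
rewrite -[RHS](@integral0 _ _ _ nu setT); apply: ae_eq_integral => //.
  by apply/measurable_EFinP; apply: measurable_csq; exact: L2_sqint.
by apply: filterS2 R0 I0 => x /= a b _; rewrite /csq a b !expr0n addr0.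
Qed.

End laguerre_basis.

(** * The Lax equation and the representation *)

Section one_sided_derivative.
Variable R : realType.
Implicit Types (f : R -> R) (t l : R).
Local Notation A := (`[0%R, +oo[%classic : set R).

Lemma has_deriv_withinD f f' t l l' : has_deriv_within A f t l ->
  has_deriv_within A f' t l' -> has_deriv_within A (fun x => f x + f' x) t (l + l').
Proof.
rewrite /has_deriv_within => a b.
rewrite (_ : (fun x => _) = (fun x => (f x - f t) / (x - t)) + (fun x => (f' x - f' t) / (x - t))).
  exact: cvgD.
apply/funext => x; rewrite -[RHS]/((f x - f t) / (x - t) + (f' x - f' t) / (x - t)).
by rewrite -mulrDl; congr (_ / _); ring.
Qed.

Lemma has_deriv_within_is_derive f t l : 0 < t -> has_deriv_within A f t l ->
  is_derive t 1 f l.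
Proof.
move=> t0 fl.
have c : (fun h : R => h^-1 *: ((f \o shift t) (h *: 1) - f t)) @ 0^' --> l.
  apply/cvgrPdist_le => e e0.
  have /cvgrPdist_le/(_ e e0) H := fl.
  have /nbhs_ballP[d /= d0 Hd] : nbhs t (fun y => y != t -> A y ->
    `|l - (f y - f t) / (y - t)| <= e) := H.
  suff : nbhs (0 : R) (fun h => h != 0 ->
    `|l - h^-1 *: ((f \o shift t) (h *: 1) - f t)| <= e) by [].
  (* The radius is at most t, so that t + h remains in the half-line where the quotient is
     controlled. *)
  apply/nbhs_ballP; exists (Num.min d t); first by rewrite /= lt_min d0.
  move=> h; rewrite /ball/= sub0r normrN lt_min => /andP[hd ht] h0.
  have := Hd (h + t); rewrite /shift/= /GRing.scale/= mulr1 addrK mulrC; apply.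
  - by rewrite /ball/= opprD addrCA subrr addr0 normrN.
  - by rewrite -subr_eq0 addrK.
  - rewrite in_itv/= andbT; move: ht; rewrite ltr_norml => /andP[+ _].
    by rewrite -subr_gt0 opprK => /ltW.
split; first by apply/cvg_ex; exists l.
exact/cvg_lim.
Qed.

Lemma has_deriv_within_cvg0 f l : has_deriv_within A f 0 l -> f x @[x --> 0^'+] --> f 0.
Proof.
move=> fl.
have q : (fun x => (f x - f 0) / (x - 0)) @ 0^'+ --> l.
  apply: cvg_trans fl; apply: cvg_app => B.
  move=> H; have H' : nbhs (0 : R) (fun y => y != 0 -> A y -> B y) := H.
  suff : nbhs (0 : R) (fun y => 0 < y -> B y) by [].
  apply: filterS H' => x Hx x0; apply: Hx; first by rewrite gt_eqF.
  by rewrite /= in_itv/= andbT ltW.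
have : (fun x => (f x - f 0) / (x - 0) * x + f 0) @ 0^'+ --> l * 0 + f 0.
  apply: cvgD; last exact: cvg_cst.
  apply: cvgM => //; apply: cvg_at_right_filter; exact: cvg_id.
rewrite mulr0 add0r; apply: cvg_trans; apply: near_eq_cvg; near=> x.
rewrite subr0 divfK ?subrK//.
Unshelve. all: by end_near. Qed.

Lemma lax_pos (r s u : R -> R)
  (hds : forall t : R, 0 <= t -> has_deriv_within A s t (- 2 * u t * r t))
  (hdr : forall t : R, 0 <= t -> has_deriv_within A r t (- 2 * u t * s t))
  (hsgn : forall t : R, 0 < t -> Num.sg (u t) = - Num.sg (r t))
  (hs0 : 0 < s 0) (hr0 : 0 < r 0)
  (hsr : forall t : R, 0 <= t -> s t ^+ 2 - r t ^+ 2 = 0) t :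
  0 <= t -> 0 < r t /\ s t = r t.
Proof.
move=> t0; pose p x := r x + s x.
have pd (x : R) : 0 <= x -> has_deriv_within A p x (- 2 * u x * p x).
  move=> x0; have := has_deriv_withinD (hdr x x0) (hds x x0).
  by congr (has_deriv_within _ _ _ _); rewrite /p; ring.
have pder (x : R) : 0 < x -> is_derive x 1 p (- 2 * u x * p x).
  by move=> x0; apply: has_deriv_within_is_derive => //; exact/pd/ltW.
have zero (x : R) : 0 <= x -> (s x - r x) * p x = 0.
  by move=> /hsr <-; rewrite /p subr_sqr [r x + _]addrC.
have p0 : 0 < p 0 by rewrite addr_gt0.
have pge : p 0 <= p t.
  apply: (@ger0_derive1_ndecry _ p 0) => // [x|x|].
  - by rewrite in_itv/= andbT => /pder[].
  - rewrite in_itv/= andbT => x0; rewrite derive1E; have [_ ->] := pder x x0.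
    (* Neither s = r nor the sign of r is known yet. At each point either s = r, and then the sign
       condition makes -2 u (2 r) nonnegative whatever the sign of r, or r + s = 0 and the
       derivative is 0; so r + s is nondecreasing. *)
    have := zero x (ltW x0); move/eqP; rewrite mulf_eq0 subr_eq0 => /orP[/eqP sr|/eqP ->];
      last by rewrite mulr0.
    rewrite /p sr; have := hsgn x x0.
    case: (sgrP (r x)) => [->|rx|rx]; first by rewrite addr0 mulr0.
      move/eqP; rewrite sgr_cp0 => ux; nra.
    move/eqP; rewrite opprK sgr_cp0 => ux; nra.
  - apply/continuous_within_itvcyP; split; last exact: has_deriv_within_cvg0 (pd 0 (lexx _)).
    move=> x; rewrite in_itv/= andbT => /pder[dx _].
    by apply: differentiable_continuous; exact/derivable1_diffP.
have pt : 0 < p t by exact: lt_le_trans pge.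
have sr : s t = r t.
  by have /eqP := zero t t0; rewrite mulf_eq0 (gt_eqF pt) orbF subr_eq0 => /eqP.
by split=> //; move: pt; rewrite /p sr -mulr2n pmulrn_lgt0.
Qed.

End one_sided_derivative.

(** * The Lax operator on finite combinations of basis vectors *)

Section representation.
Variable R : realType.

(** The coefficients vanish from [N] on, so the sum over all of nat in [lin_ext] has finite
    support. *)
Lemma lin_ext_sum (w : nat -> ell2 R) N (c : nat -> R[i]) :
  lin_ext w (\sum_(n < N) c n *: ell2_e n) = \sum_(n < N) c n *: w n.
Proof.
rewrite /lin_ext; under eq_fsbigr do rewrite (dot_lincomb (@ell2_e_on R)).
rewrite -(fsbig_widen `I_N setT)//=; last first.
  by move=> n [_ /negP nN]; rewrite /= (negbTE nN) scale0r.
rewrite -fsbig_ord/=; apply: eq_bigr => i _; by rewrite ltn_ord.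
Qed.

Lemma Lax00 (s r : R -> R) t : Lax s r t 0 0 = (s t)%:C.
Proof. by rewrite /Lax !mxE /= !mulr1 subrr mulr0 addr0. Qed.

Lemma Lax01 (s r : R -> R) t : Lax s r t 0 1 = (r t)%:C.
Proof. by rewrite /Lax !mxE /= mul0r mulr0 add0r subr0 mulr1. Qed.

Lemma Lax10 (s r : R -> R) t : Lax s r t 1 0 = - (r t)%:C.
Proof. by rewrite /Lax !mxE /= mul0r mulr0 add0r sub0r mulrN1. Qed.

Context d (T : measurableType d) (mu : {measure set T -> \bar R}).

Lemma L2_ZE a (f : L2 mu) : {ae mu, forall x, (a *: f : L2 mu) x = a * f x}.
Proof. exact: L2_scaleE. Qed.

(** Measurability of [F] is asked for separately: without completeness of [mu] it does not pass
    through a.e. equality. *)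
Lemma sqint_ae (F G : T -> R[i]) : measurable_fun setT (Re \o F) ->
  measurable_fun setT (Im \o F) -> G \in sqint mu ->
  {ae mu, forall x, F x = G x} -> F \in sqint mu.
Proof.
move=> mr mi Gs FG; apply/sqintP; split=> //.
have /sqintP[_ _] := Gs; rewrite (ae_eq_integral (fun x => (csq (F x))%:E))//.
- by apply/measurable_EFinP; exact: (measurable_csq Gs).
- apply/measurable_EFinP; apply: measurable_funD.
    exact: (@measurable_funX _ _ _ _ (Re \o F)).
  exact: (@measurable_funX _ _ _ _ (Im \o F)).
- by apply: filterS FG => x -> _.
Qed.

Lemma ae_sum_mul (m : T -> R[i]) (c : nat -> R[i]) (phi xi : nat -> L2 mu) N :
  (forall n, {ae mu, forall x, xi n x = m x * phi n x}) ->
  {ae mu, forall x, (\sum_(n < N) c n *: xi n : L2 mu) x =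
                    m x * (\sum_(n < N) c n *: phi n : L2 mu) x}.
Proof.
move=> xiE.
have z0 : {ae mu, forall x, (0 : L2 mu) x = 0}.
  have := L2_ZE 0 (0 : L2 mu); rewrite scale0r; apply: filterS => x ->.
  exact: mul0r.
elim: N => [|N IH].
  by rewrite !big_ord0; apply: filterS z0 => x ->; rewrite mulr0.
rewrite !big_ord_recr/=.
set a := \sum_(_ < N) _; set b := \sum_(_ < N) _.
apply: filterS3 (xiE N) (filterI (L2_addE a (c N *: xi N)) (L2_addE b (c N *: phi N)))
  (filterI (L2_ZE (c N) (xi N)) (filterI (L2_ZE (c N) (phi N)) IH)).
move=> x E [Ea Eb] [E1 [E2 E3]].
by rewrite Ea Eb E3 mulrDr E1 E2 E mulrCA.
Qed.

Lemma ae_comb3 (r a b e : R[i]) (f g h : L2 mu) (F G H : T -> R[i]) :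
  {ae mu, forall x, f x = F x} -> {ae mu, forall x, g x = G x} ->
  {ae mu, forall x, h x = H x} ->
  {ae mu, forall x, (r *: (a *: f + b *: g + e *: h) : L2 mu) x =
                    r * (a * F x + b * G x + e * H x)}.
Proof.
move=> fF gG hH.
apply: filterS3 (filterI (L2_ZE r (a *: f + b *: g + e *: h))
    (filterI (L2_addE (a *: f + b *: g) (e *: h)) (L2_addE (a *: f) (b *: g))))
  (filterI (L2_ZE a f) (filterI (L2_ZE b g) (L2_ZE e h))) (filterI fF (filterI gG hH)).
by move=> x [-> [-> ->]] [-> [-> ->]] [-> [-> ->]].
Qed.

End representation.

Lemma linear_comb3 (K : nzRingType) (V W : lmodType K) (U : {linear V -> W})
    (c p a b e : K) (x y z : V) :
  U (c *: (p *: (a *: x + b *: y + e *: z))) =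
  c *: (p *: (a *: U x + b *: U y + e *: U z)).
Proof. by rewrite !linearZ_LR !linearD !linearZ_LR. Qed.

Lemma complex_comb3 (R : realType) (p a b e x y z : R) :
  p%:C * (a%:C * x%:C + b%:C * y%:C + e%:C * z%:C) =
  (p * (a * x + b * y + e * z))%:C :> R[i].
Proof. by apply: complexP => /=; ring. Qed.

Section laguerre_multiplication.
Variables (R : realType) (k r : R).
Hypotheses (k0 : 0 < k) (r0 : 0 < r).

Lemma lag_vec_mul n : {ae (Wmeasure k r), forall x,
  (r%:C *: ((up_coef k n)%:C *: lag_vec k r n.+1 + (2 * (k + n%:R))%:C *: lag_vec k r n
    + (down_coef k n)%:C *: lag_vec k r n.-1) : L2W k r) x = x%:C * lag_vec k r n x}.
Proof.
apply: filterS2 (ae_comb3 r%:C (up_coef k n)%:C (2 * (k + n%:R))%:C (down_coef k n)%:C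
  (lag_vecE k0 r0 n.+1) (lag_vecE k0 r0 n) (lag_vecE k0 r0 n.-1)) (lag_vecE k0 r0 n).
move=> x Ex E0; apply: (etrans Ex); rewrite E0.
rewrite complex_comb3 -(lag_rec k0 r0) rmorphM.
by [].
Qed.

End laguerre_multiplication.

Theorem theorem4p4 (R : realType) (r s u : R -> R) (k : R)
  (hr : C1_on `[0%R, +oo[ r)
  (hs : C1_on `[0%R, +oo[ s)
  (hu : {within `[0%R, +oo[, continuous u})
  (hds : forall t : R, 0 <= t ->
    has_deriv_within `[0%R, +oo[ s t (- 2 * u t * r t))
  (hdr : forall t : R, 0 <= t ->
    has_deriv_within `[0%R, +oo[ r t (- 2 * u t * s t))
  (hsgn : forall t : R, 0 < t -> Num.sg (u t) = - Num.sg (r t))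
  (hs0 : 0 < s 0) (hr0 : 0 < r 0)
  (hsr : forall t : R, 0 <= t -> s t ^+ 2 - r t ^+ 2 = 0)
  (hk : 0 < k) :
  forall t : R, 0 <= t ->
  exists U : {linear ell2 R -> L2W k (r t)},
    [/\ is_transform U,
        forall V : {linear ell2 R -> L2W k (r t)}, is_transform V -> V =1 U
      & exists Us : {linear L2W k (r t) -> ell2 R},
          unitary_op U Us /\
          eq_op_on (U @` fin_span)
            (comp_op (total_op U)
               (comp_op (pi_rep k (Lax s r t)) (total_op Us)))
            (mul_op (mu := Wmeasure k (r t)) (fun x : R => x%:C))].

Proof.
move=> t t0; have [rt st] := lax_pos hds hdr hsgn hs0 hr0 hsr t0.
have [U [bU Ue Uuniq [Us unitU]]] := hilbert_basis_unitary
  (lag_vec_on hk rt) (lag_vec_complete hk rt).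
exists U; split.
- by split=> // n; rewrite Ue; exact: lag_vecE.
- move=> V [bV Ve]; apply: Uuniq => // n; apply/L2P.
  by apply: filterS2 (Ve n) (lag_vecE hk rt n) => x -> ->.
(* [UK] turns [Us (U v)] back into [v], so everything is computed on a finite combination. *)
exists Us; split=> //; case: unitU => _ UK _ _ [v [N [c vE]] <-].
pose phi := lag_vec k (r t).
pose xi n := (r t)%:C *: ((up_coef k n)%:C *: phi n.+1 + (2 * (k + n%:R))%:C *: phi n
    + (down_coef k n)%:C *: phi n.-1).
have Uv : U v = \sum_(n < N) c n *: phi n.
  by rewrite vE linear_sum; apply: eq_bigr => n _; rewrite linearZ_LR Ue.
have Upi : U (op_app (pi_rep k (Lax s r t)) v) = \sum_(n < N) c n *: xi n.
  have -> : op_app (pi_rep k (Lax s r t)) v = \sum_(n < N) c n *: ((r t)%:C *: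
      ((up_coef k n)%:C *: ell2_e n.+1 + (2 * (k + n%:R))%:C *: ell2_e n
       + (down_coef k n)%:C *: ell2_e n.-1)).
    (* Here s = r enters: the diagonal entry becomes 2 r (k + n), and r factors out of the whole
       row. The minus signs of [Lax10] and [rep_F] cancel. *)
    rewrite /= Lax00 Lax01 Lax10 vE /rep_H /rep_E /rep_F !lin_ext_sum st.
    rewrite !scaler_sumr -!big_split/=; apply: eq_bigr => n _.
    rewrite !scalerDr !scalerA -/(up_coef k n) -/(down_coef k n) [X in X + _]addrC.
    by congr (_ *: _ + _ *: _ + _ *: _); ring.
  rewrite linear_sum; apply: eq_bigr => n _.
  by rewrite linear_comb3 !Ue.
pose Y : L2W k (r t) := U v; pose Z : L2W k (r t) := \sum_(n < N) c n *: xi n.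
have ZY : {ae (Wmeasure k (r t)), forall x, Z x = x%:C * Y x}.
  rewrite /Y Uv; apply: ae_sum_mul => n; exact: lag_vec_mul.
(* [U v] lies in the domain of multiplication by x because the product agrees a.e. with [Z], which
   is already in L^2. *)
have dom : (fun x : R => x%:C * Y x) \in sqint (Wmeasure k (r t)).
  have /sqintP[mr mi _] := L2_sqint Y.
  apply: (sqint_ae _ _ (L2_sqint Z)).
  - rewrite (_ : _ \o _ = (fun x : R => x * Re (Y x))); first exact: measurable_funM.
    by apply/funext => x /=; rewrite cReM/= mul0r subr0.
  - rewrite (_ : _ \o _ = (fun x : R => x * Im (Y x))); first exact: measurable_funM.
    by apply/funext => x /=; rewrite cImM/= mul0r addr0.
  - by apply: filterS ZY => x ->.
split.
- by rewrite /= UK; do !split => //; exists N, c.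
- exact: dom.
- have -> : op_app (comp_op (total_op U) (comp_op (pi_rep k (Lax s r t)) (total_op Us))) (U v) = Z.
    by rewrite /= UK; exact: Upi.
  apply/L2P; apply: filterS2 ZY (L2_classE dom) => x E1 E2.
  by apply: (etrans E1); apply: esym; exact: E2.
Qed.
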